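(* Let $A\in\mathbb{R}^{d\times n}$ have rank $d$ and no zero columns. The singular locus of the reciprocal plane $\mathcal{L}^{-1}$ (regarded as a $d$-dimensional affine variety in $\mathbb{C}^n$) is pure of codimension $2$ in $\mathcal{L}^{-1}$. It is the union of all boundary strata $\mathcal{L}_J^{-1}$, over flats $J$ of $M(A)$, such that the contraction $M(A/J)$ is a non-basic matroid.
   Context: $\mathcal{L}\subset\mathbb{C}^n$ is the row space of $A$, and $\mathcal{L}^{-1}\subset\mathbb{C}^n$ is the Zariski closure of $\{(1/u_1,\dots,1/u_n): u\in\mathcal{L}\cap(\mathbb{C}^* )^n\}$. $M(A)$ is the matroid on $[n]$ of the columns $A_1,\dots,A_n$; a flat is a set $J$ with $J=\{i:A_i\in\mathrm{span}(A_j:j\in J)\}$. For a flat $J$, the boundary stratum is $\mathcal{L}_J^{-1}=\{p\in\mathcal{L}^{-1}:\mathrm{supp}(p)\subseteq J\}$; it is isomorphic to the reciprocal plane of the row space of $A_J=(A_j:j\in J)$. The contraction $M(A/J)$ is the matroid on $[n]\setminus J$ of the images of $A_i$, $i\notin J$, in $\mathbb{R}^d/\mathrm{span}(A_j:j\in J)$. A loopless matroid of rank $r$ is basic if it has exactly $r$ rank-one flats (equivalently, the representing vectors lie on exactly $r$ distinct lines), and non-basic otherwise. The empty set is considered pure of any codimension. *)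

(* Defs.v *)
From HB Require Import structures.
From mathcomp Require Import all_boot all_order all_algebra.
From mathcomp Require Import boolp classical_sets reals complex mpoly.

Set Implicit Arguments.
Unset Strict Implicit.
Unset Printing Implicit Defensive.

Import GRing.Theory.

Local Open Scope ring_scope.

Section VectorMatroid.
Variables (F : fieldType) (V : vectType F) (n : nat).
Implicit Types (a : 'I_n -> V) (E J : {set 'I_n}).

Definition vspan a J : {vspace V} := <<[seq a j | j in J]>>%VS.

(* The matroid of the vector family (a i) for i in E is represented by the
   pair (a, E); the values of a outside the ground set E are irrelevant. *)
Definition flat a E J : bool :=
  (J \subset E) && (J == [set i in E | a i \in vspan a J])%SET.

Definition mrank a J : nat := \dim (vspan a J).

Definition basic a E : bool :=
  #|[set J | flat a E J & mrank a J == 1%N]%SET| == mrank a E.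

(* The quotient map V -> V / W, where V / W is realized as the complement
   W^C of W: the linear projection onto W^C with kernel W (see quov_eq0
   and quov_img). *)
Definition quov (W : {vspace V}) : 'End(V) := (\1 - projv W)%VF.

Lemma quovE W v : quov W v = v - projv W v.
Proof. by rewrite /quov add_lfunE opp_lfunE id_lfunE. Qed.

Lemma quov_eq0 W v : (quov W v == 0) = (v \in W).
Proof.
rewrite quovE subr_eq0; apply/eqP/idP => [->|/projv_id //].
exact: memv_pi.
Qed.

Lemma quov_img W : limg (quov W) = (W^C)%VS.
Proof.
have kerW : lker (quov W) = W by apply/vspaceP => v; rewrite memv_ker quov_eq0.
apply/eqP; rewrite eqEdim; apply/andP; split.
  by apply/subvP => _ /memv_imgP[v _ ->]; rewrite quovE memv_projC.
have := limg_ker_dim (quov W) fullv.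
by rewrite capfv kerW dimv_compl => <-; rewrite addKn.
Qed.

(* Contraction of a flat J: the family of images in V / span(a j : j in J),
   to be taken on the ground set ~: J. *)
Definition contraction a J : 'I_n -> V := fun i => quov (vspan a J) (a i).

End VectorMatroid.

Local Open Scope classical_set_scope.

Section AffineVarieties.
Variables (K : closedFieldType) (n : nat).
Implicit Types (S X Y Z : set 'rV[K]_n) (p v : 'rV[K]_n) (f : {mpoly K[n]}).

Definition vanishing_ideal S : set {mpoly K[n]} :=
  [set f | forall p, S p -> f.@[p 0] = 0].

Definition zariski_closure S : set 'rV[K]_n :=
  [set p | forall f, vanishing_ideal S f -> f.@[p 0] = 0].

Definition zariski_closed S : Prop := zariski_closure S = S.

Definition irreducible_closed Z : Prop :=
  [/\ zariski_closed Z, Z !=set0 &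
      forall Z1 Z2, zariski_closed Z1 -> zariski_closed Z2 ->
        Z = Z1 `|` Z2 -> Z = Z1 \/ Z = Z2].

Definition irreducible_component Z Y : Prop :=
  [/\ irreducible_closed Z, Z `<=` Y &
      forall Z', irreducible_closed Z' -> Z' `<=` Y -> Z `<=` Z' -> Z' = Z].

(* C 0 < C 1 < ... < C k, all irreducible closed subsets of X. *)
Definition irreducible_chain X (C : nat -> set 'rV[K]_n) (k : nat) : Prop :=
  (forall i, (i <= k)%N -> irreducible_closed (C i) /\ C i `<=` X) /\
  (forall i, (i < k)%N -> C i `<` C i.+1).

(* For Z irreducible closed in X: codim(Z, X) = c, the maximal length of a
   chain of irreducible closed subsets of X starting at Z. *)
Definition has_codim Z X (c : nat) : Prop :=
  (exists2 C, irreducible_chain X C c & C 0%N = Z) /\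
  (forall C k, irreducible_chain X C k -> C 0%N = Z -> (k <= c)%N).

(* Vacuously true of Y = set0, for every c. *)
Definition pure_codim (c : nat) Y X : Prop :=
  zariski_closed Y /\ forall Z, irreducible_component Z Y -> has_codim Z X c.

Definition tangent_space X p : set 'rV[K]_n :=
  [set v | forall f, vanishing_ideal X f ->
             \sum_(i < n) (mderiv i f).@[p 0] * v 0 i = 0].

(* The Zariski tangent space at p has dimension equal to that of X at p; the
   latter, the Krull dimension of the local ring, is codim({p}, X). *)
Definition regular_point X p : Prop :=
  exists2 T : {vspace 'rV[K]_n},
    (forall v, v \in T <-> tangent_space X p v) & has_codim [set p] X (\dim T).

Definition singular_locus X : set 'rV[K]_n :=
  [set p | X p /\ ~ regular_point X p].

End AffineVarieties.

Section ReciprocalPlane.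
Variables (R : realType) (d n : nat) (A : 'M[R]_(d, n)).

Definition row_space : set 'rV[R[i]]_n :=
  [set u | (u <= map_mx (real_complex R) A)%MS].

Definition reciprocal_plane : set 'rV[R[i]]_n :=
  zariski_closure [set p | exists u, [/\ row_space u,
    forall i, u 0 i != 0 & p = \row_i (u 0 i)^-1]].

Definition stratum (J : {set 'I_n}) : set 'rV[R[i]]_n :=
  [set p | reciprocal_plane p /\ forall i, p 0 i != 0 -> i \in J].

Definition columns : 'I_n -> 'cV[R]_d := fun i => col i A.

End ReciprocalPlane.

(* Main.v *)
(* Let X be the reciprocal plane and let J be a flat. The points of X with
   support J are the vectors equal to 1/u on J and to 0 elsewhere, for u in L
   nonvanishing on J: such a vector is the limit at s = 0 of 1/(u + w/s), where
   w in L vanishes exactly on J. Differentiating rational curves of this kind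
   gives tangent vectors of X at such a point p: the vectors p^2 w supported on
   J, for w in L, and one vector supported on G \ J for every flat G covering J.
   Conversely, the linear relations among the columns, cleared of denominators,
   vanish on X and force every tangent vector to be a combination of these.
   Hence the tangent space has dimension rank J plus the number of covers of J,
   which are the rank-one flats of M(A/J), so that p is regular if and only if
   M(A/J) is basic.

   A chain of k + 1 irreducible closed sets gives k polynomials whose monomials
   are linearly independent on X; counting monomials after clearing denominators
   in 1/u yields k <= d. Chains of length d through every point and every stratum
   are obtained from flags of affine slices of L and from flags of flats.

   Finally, a non-basic M(A/J) has a non-basic contraction of rank 2, so the
   components of the singular locus are strata of flats of corank 2. *)
Require Import Defs.
From mathcomp Require Import all_boot all_order all_algebra.

Set Implicit Arguments.
Unset Strict Implicit.
Unset Printing Implicit Defensive.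

Import GRing.Theory.

Local Open Scope ring_scope.

(** * Vector matroids *)

Section VectorFamilies.
Variables (F : fieldType) (V : vectType F) (n : nat).
Implicit Types (a : 'I_n -> V) (J : {set 'I_n}) (v : V).

Definition closure a J := [set i | a i \in vspan a J].

Lemma closureP a J i : (i \in closure a J) = (a i \in vspan a J).
Proof. by rewrite inE. Qed.

Lemma vspan_mem a J i : i \in J -> a i \in vspan a J.
Proof. by move=> iJ; apply/memv_span/map_f; rewrite mem_enum. Qed.

Lemma vspan_subvP a J (U : {vspace V}) :
  reflect (forall i, i \in J -> a i \in U) (vspan a J <= U)%VS.
Proof.
apply: (iffP span_subvP) => [sub i iJ|sub _ /mapP[i iJ ->]].
  by apply/sub/map_f; rewrite mem_enum.
by apply: sub; rewrite mem_enum in iJ.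
Qed.

Lemma vspanS a J1 J2 : J1 \subset J2 -> (vspan a J1 <= vspan a J2)%VS.
Proof. by move=> /subsetP sub; apply/vspan_subvP => i /sub; exact: vspan_mem. Qed.

Lemma vspanU a J1 J2 : vspan a (J1 :|: J2) = (vspan a J1 + vspan a J2)%VS.
Proof.
apply/eqP; rewrite eqEsubv subv_add (vspanS _ (subsetUl _ _)) (vspanS _ (subsetUr _ _)).
rewrite !andbT.
apply/vspan_subvP => i /setUP[iJ|iJ].
  exact/(subvP (addvSl _ _))/vspan_mem.
exact/(subvP (addvSr _ _))/vspan_mem.
Qed.

Lemma vspan1 a i : vspan a [set i] = <[a i]>%VS.
Proof.
apply/eqP; rewrite eqEsubv -memvE vspan_mem ?inE // andbT.
by apply/vspan_subvP => j /set1P ->; exact: memv_line.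
Qed.

Lemma vspan_expand a J v : v \in vspan a J ->
  exists k : 'I_n -> F, v = \sum_(j in J) k j *: a j.
Proof.
rewrite /vspan span_def big_map big_enum /= => /memv_sumP[w wJ ->].
have /fin_all_exists[k wk] j : exists k, j \in J -> w j = k *: a j.
  have [jJ|_] := boolP (j \in J); last by exists 0.
  by have /vlineP[k ->] := wJ _ jJ; exists k.
by exists k; apply: eq_bigr.
Qed.

Lemma sub_closure a J : J \subset closure a J.
Proof. by apply/subsetP => i iJ; rewrite closureP vspan_mem. Qed.

Lemma vspan_closure a J : vspan a (closure a J) = vspan a J.
Proof.
apply/eqP; rewrite eqEsubv (vspanS _ (sub_closure _ _)) andbT.
by apply/vspan_subvP => i; rewrite closureP.
Qed.

Lemma flatE a J : flat a [set: 'I_n] J = (J == closure a J).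
Proof.
rewrite /flat subsetT /=; congr (J == _).
by apply/setP => i; rewrite !inE.
Qed.

Lemma closure_flat a J : flat a [set: 'I_n] (closure a J).
Proof. by rewrite flatE; apply/eqP/setP => i; rewrite !closureP vspan_closure. Qed.

Lemma mem_flat a J : flat a [set: 'I_n] J ->
  forall i, (i \in J) = (a i \in vspan a J).
Proof. by rewrite flatE => /eqP eJ i; rewrite {1}eJ closureP. Qed.

Lemma closure_sub_flat a J J' : flat a [set: 'I_n] J' -> J \subset J' ->
  closure a J \subset J'.
Proof.
move=> fJ' sub; apply/subsetP => i; rewrite closureP (mem_flat fJ').
exact/subvP/vspanS.
Qed.

Lemma flat_ind_eq a J J' : flat a [set: 'I_n] J -> flat a [set: 'I_n] J' ->
  J \subset J' -> (mrank a J' <= mrank a J)%N -> J = J'.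
Proof.
move=> fJ fJ' sub rk; have eV : vspan a J = vspan a J'.
  by apply/eqP; rewrite eqEdim vspanS.
by apply/setP => i; rewrite (mem_flat fJ) (mem_flat fJ') eV.
Qed.

Definition covers a J : {set {set 'I_n}} :=
  [set G : {set 'I_n} | [&& flat a [set: 'I_n] G, J \subset G &
                          mrank a G == (mrank a J).+1]].

Lemma mrank_closure1 a J e : a e \notin vspan a J ->
  mrank a (closure a (e |: J)) = (mrank a J).+1.
Proof.
move=> eJ; rewrite /mrank vspan_closure vspanU vspan1 dimv_disjoint_sum.
  rewrite dim_vline; case: eqP => [e0|_]; last by rewrite add1n.
  by rewrite e0 mem0v in eJ.
apply/eqP; rewrite -subv0; apply/subvP => v; rewrite memv_cap => /andP[].
move=> /vlineP[k ->] kJ; rewrite memv0; case: (eqVneq k 0) => [->|k0].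
  by rewrite scale0r.
by case/negP: eJ; rewrite -(scalerK k0 (a e)) memvZ.
Qed.

Lemma closure1_covers a J e : a e \notin vspan a J ->
  closure a (e |: J) \in covers a J.
Proof.
move=> eJ; rewrite inE closure_flat mrank_closure1 // eqxx andbT /=.
exact: subset_trans (subsetUr _ _) (sub_closure _ _).
Qed.

Lemma coversE a J G e : G \in covers a J -> e \in G -> a e \notin vspan a J ->
  G = closure a (e |: J).
Proof.
rewrite inE => /and3P[fG JG /eqP rG] eG eJ; apply/esym.
apply: (flat_ind_eq (closure_flat _ _) fG); last by rewrite mrank_closure1 ?rG.
by apply: closure_sub_flat => //; rewrite subUset sub1set eG.
Qed.

(* The flats of rank one of the contraction by a flat J are the sets G :\: J,
   for the flats G covering J. *)
Lemma vspan_contraction a J S :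
  vspan (contraction a J) S = (quov (vspan a J) @: vspan a (J :|: S))%VS.
Proof.
apply/eqP; rewrite eqEsubv; apply/andP; split.
  apply/vspan_subvP => i iS; apply/memv_img/vspan_mem.
  by rewrite inE iS orbT.
apply/subvP => _ /memv_imgP[v + ->]; rewrite vspanU => /memv_addP[x xJ [y yS ->]].
have /eqP qx0 : quov (vspan a J) x == 0 by rewrite quov_eq0.
rewrite linearD /= qx0 add0r.
have -> : vspan (contraction a J) S = (quov (vspan a J) @: vspan a S)%VS.
  by rewrite limg_span /vspan -map_comp.
exact: memv_img.
Qed.

Lemma mrank_contraction a J S :
  (mrank (contraction a J) S + mrank a J)%N = mrank a (J :|: S).
Proof.
rewrite /mrank vspan_contraction -(limg_ker_dim (quov (vspan a J)) (vspan a (J :|: S))).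
rewrite addnC; congr (\dim _ + _)%N; apply/vspaceP => v.
rewrite memv_cap memv_ker quov_eq0 andbC; case: (boolP (v \in _)) => //= vJ.
by apply/esym/(subvP _ _ vJ)/vspanS/subsetUl.
Qed.

Lemma mem_contraction a J S i :
  (contraction a J i \in vspan (contraction a J) S) = (a i \in vspan a (J :|: S)).
Proof.
rewrite vspan_contraction; apply/idP/idP => [/memv_imgP[v vS]|]; last exact: memv_img.
move/eqP; rewrite -subr_eq0 -linearB quov_eq0 => ivJ.
rewrite -(subrK v (a i)) memvD //; apply/(subvP _ _ ivJ)/vspanS/subsetUl.
Qed.

Lemma card_flats1_contraction a J : flat a [set: 'I_n] J ->
  #|[set S | flat (contraction a J) (~: J) S & mrank (contraction a J) S == 1%N]| =
  #|covers a J|.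
Proof.
move=> fJ; rewrite -(@card_in_imset _ _ (fun S => J :|: S)); last first.
  move=> S1 S2; rewrite !inE => /andP[/andP[s1 _] _] /andP[/andP[s2 _] _].
  have sD (S : {set 'I_n}) : S \subset ~: J -> S = (J :|: S) :\: J.
    move=> sS; rewrite setDUl setDv set0U; apply/esym/setDidPl.
    by rewrite disjoints_subset.
  by move=> e; rewrite (sD _ s1) (sD _ s2) e.
apply: eq_card => G; apply/imsetP/idP => [[S + ->]|].
  rewrite !inE => /andP[/andP[sS /eqP fS] /eqP rS].
  rewrite subsetUl -mrank_contraction rS add1n eqxx !andbT flatE.
  apply/eqP/setP => i; rewrite closureP -mem_contraction.
  have [iJ|iJ] := boolP (i \in J).
    by rewrite mem_contraction vspan_mem ?inE iJ.
  by rewrite inE (negPf iJ) /= {1}fS !inE iJ.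
rewrite inE => /and3P[fG JG /eqP rG]; have eG : J :|: G :\: J = G.
  by rewrite setDE setUIr setUCr setIT; apply/setUidPr.
exists (G :\: J) => //; rewrite !inE /flat setDE subsetIr /=; apply/andP; split.
  by apply/eqP/setP => i; rewrite !inE mem_contraction -setDE eG -(mem_flat fG) andbC.
by rewrite -(eqn_add2r (mrank a J)) mrank_contraction -setDE eG rG.
Qed.

(** Ranks in the contraction are ranks over [J] minus the rank of [J], and its rank-one flats
    correspond to the covers of [J]. In this numerical form basicness can be compared with the
    dimension of a tangent space. *)
Lemma basicE a J : flat a [set: 'I_n] J ->
  basic (contraction a J) (~: J) =
  (#|covers a J| + mrank a J == mrank a [set: 'I_n])%N.
Proof.
move=> fJ; rewrite /basic card_flats1_contraction // -(setUCr J).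
by rewrite -mrank_contraction eqn_add2r.
Qed.

Definition indep a J := free [seq a j | j in J].

Lemma indepU1 a J i : indep a J -> a i \notin vspan a J -> indep a (i |: J).
Proof.
move=> iJ niJ; have nJ : i \notin J by apply: contra niJ; exact: vspan_mem.
have pe : perm_eq [seq a j | j in i |: J] (a i :: [seq a j | j in J]).
  rewrite -[_ :: _]/(map a (i :: enum J)); apply: perm_map.
  apply: uniq_perm => /= [||j]; rewrite ?enum_uniq ?mem_enum ?andbT //.
  by rewrite in_cons !mem_enum !inE.
by rewrite /indep (perm_free pe) free_cons niJ.
Qed.

Lemma indepD1 a J i : indep a J -> i \in J -> a i \notin vspan a (J :\ i).
Proof.
move=> iJ niJ; have pe : perm_eq [seq a j | j in J] (a i :: [seq a j | j in J :\ i]).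
  rewrite -[_ :: _]/(map a (i :: enum (J :\ i))); apply: perm_map.
  apply: uniq_perm => /= [||j]; rewrite ?enum_uniq ?mem_enum ?setD11 //.
  by rewrite in_cons !mem_enum !inE; case: eqP => // ->; rewrite niJ.
by move: iJ; rewrite /indep (perm_free pe) free_cons => /andP[].
Qed.

Lemma indepS a J J' : J' \subset J -> indep a J -> indep a J'.
Proof.
move=> /subsetP sub; pose X := enum J'; pose Y := enum (J :\: J').
have pe : perm_eq [seq a j | j in J] (map a X ++ map a Y).
  rewrite -map_cat; apply: perm_map; apply: uniq_perm; rewrite ?enum_uniq //.
    rewrite cat_uniq !enum_uniq /= andbT; apply/hasPn => j.
    by rewrite !mem_enum inE => /andP[].
  move=> j; rewrite mem_cat !mem_enum inE.
  by case: (boolP (j \in J')) => //= /sub ->.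
by rewrite /indep (perm_free pe) => /catl_free.
Qed.

Lemma mrank_indep a J : indep a J -> mrank a J = #|J|.
Proof. by rewrite /indep /free => /eqP; rewrite size_map -cardE. Qed.

Lemma indep_extend a B J : indep a B -> B \subset J ->
  exists S : {set 'I_n}, [/\ B \subset S, S \subset J, indep a S & vspan a S = vspan a J].
Proof.
move=> iB sB; pose P (S : {set 'I_n}) := indep a S && (S \subset J).
have [|S /maxsetP[/andP[iS SJ] mS] BS] := @maxset_exists _ P B; first by rewrite /P iB.
exists S; split=> //; apply/eqP; rewrite eqEsubv vspanS //=.
apply/vspan_subvP => i iJ; apply/negPn/negP => niS.
case/negP: (niS); apply: vspan_mem.
rewrite -(mS (i |: S)) ?setU11 ?subsetUr //.
by rewrite /P indepU1 // subUset sub1set iJ.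
Qed.

(** An element of [S :&: J] outside [B] would lie in the span of [B], hence in the span of the other
    members of [S]. *)
Lemma indep_flatI a (B S J : {set 'I_n}) : indep a S -> B \subset S -> B \subset J ->
  vspan a B = vspan a J -> S :&: J = B.
Proof.
move=> iS BS BJ eV; apply/eqP; rewrite eq_sym eqEsubset subsetI BS BJ /=.
apply/subsetP => i /setIP[iS' iJ]; apply/negPn/negP => niB.
case/negP: (indepD1 iS iS').
have: a i \in vspan a B by rewrite eV vspan_mem.
apply/subvP/vspanS/subsetP => j jB; rewrite !inE (subsetP BS) // andbT.
by apply: contra niB => /eqP <-.
Qed.

End VectorFamilies.

(** The projection with kernel [U] does not kill [x], so one of its coordinates, rescaled, is the
    required form. *)
Lemma separating_form (F : fieldType) d (U : {vspace 'cV[F]_d}) (x : 'cV_d) :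
  x \notin U ->
  exists2 t : 'rV_d, (forall y, y \in U -> (t *m y) 0 0 = 0) & (t *m x) 0 0 = 1.
Proof.
rewrite -quov_eq0 => qx; have [k kx] : exists k, quov U x k 0 != 0.
  apply/existsP; apply: contraR qx; rewrite negb_exists => /forallP h.
  apply/eqP/matrixP => i j; rewrite ord1 mxE; apply/eqP.
  by move: (h i); rewrite negbK.
pose t : 'rV_d := \row_j quov U (delta_mx j 0) k 0.
have tE y : (t *m y) 0 0 = quov U y k 0.
  have {2}-> : y = \sum_j y j 0 *: delta_mx j 0.
    rewrite {1}[y]matrix_sum_delta; apply: eq_bigr => j _.
    by rewrite (big_ord_recl 0) big_ord0 addr0.
  rewrite linear_sum summxE mxE; apply: eq_bigr => j _.
  by rewrite linearZ !mxE mulrC.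
exists ((quov U x k 0)^-1 *: t) => [y yU|]; rewrite -scalemxAl mxE tE.
  by move: yU; rewrite -quov_eq0 => /eqP ->; rewrite mxE mulr0.
by rewrite mulVf.
Qed.

(** * Bases adapted to a flat, and a coordinate criterion for non-basic contractions *)

Section AdaptedBasis.
Variables (F : fieldType) (d n : nat) (a : 'I_n -> 'cV[F]_d).
Implicit Types (J S : {set 'I_n}).

Definition form_at (t : 'rV[F]_d) i := (t *m a i) 0 0.

(* S indexes a basis of the span of all a i, with dual forms t, and S :&: J
   indexes a basis of the span of the flat J. *)
Record adapted J S (t : 'I_n -> 'rV[F]_d) : Prop := Adapted {
  dual_form : forall s s', s \in S -> s' \in S -> form_at (t s) s' = (s == s')%:R;
  adapted_expand : forall i, a i = \sum_(s in S) form_at (t s) i *: a s;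
  adapted_flat : forall i, i \in J <-> forall s, s \in S :\: J -> form_at (t s) i = 0;
  adapted_mrank : mrank a J = #|S :&: J|;
  adapted_card : mrank a [set: 'I_n] = #|S| }.

Lemma form_vspan (t : 'rV[F]_d) J y : (forall j, j \in J -> form_at t j = 0) ->
  y \in vspan a J -> (t *m y) 0 0 = 0.
Proof.
move=> tJ; pose f : 'Hom('cV[F]_d, 'M[F]_1) := linfun (mulmx t).
have sub : (vspan a J <= lker f)%VS.
  apply/vspan_subvP => i iJ; rewrite memv_ker lfunE; apply/eqP/matrixP => x y'.
  by rewrite !ord1 [RHS]mxE; apply: tJ.
by move=> /(subvP sub); rewrite memv_ker lfunE => /eqP ->; rewrite mxE.
Qed.


(** Duality identifies the coefficients of an expansion over any part of [S] with the values of the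
    forms [t]; the remaining properties are read off from the expansions over [S] and [S :&: J]. *)
Lemma adapted_intro S J t : flat a [set: 'I_n] J ->
  (forall s s', s \in S -> s' \in S -> form_at (t s) s' = (s == s')%:R) ->
  indep a S -> vspan a S = vspan a [set: 'I_n] -> vspan a (S :&: J) = vspan a J ->
  adapted J S t.
Proof.
move=> fJ td iS eS eJ; have expand (S' : {set 'I_n}) i : S' \subset S ->
    a i \in vspan a S' -> a i = \sum_(s in S') form_at (t s) i *: a s.
  move=> /subsetP S'S /vspan_expand[k ek]; rewrite {1}ek; apply: eq_bigr => s sS'.
  congr (_ *: _); rewrite /form_at ek mulmx_sumr summxE (bigD1 s) //=.
  rewrite -scalemxAr mxE -/(form_at _ _) td ?S'S // eqxx mulr1 big1 ?addr0 //.
  move=> j /andP[jS' ne]; rewrite -scalemxAr mxE -/(form_at _ _) td ?S'S //.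
  by rewrite eq_sym (negPf ne) mulr0.
have inS i : a i \in vspan a S by rewrite eS vspan_mem ?inE.
split => //; first by move=> i; exact: expand.
- move=> i; split=> [iJ s /setDP[sS sJ]|ci].
    move: (vspan_mem a iJ); rewrite -eJ; apply: form_vspan => j /setIP[jS jJ].
    by rewrite td //; case: eqP => // sj; rewrite sj jJ in sJ.
  rewrite (mem_flat fJ) -eJ (expand S i) //; apply: rpred_sum => s sS.
  have [sJ|sJ] := boolP (s \in J); first by rewrite rpredZ // vspan_mem // inE sS.
  by rewrite ci ?scale0r ?mem0v // inE sJ.
- by rewrite /mrank -eJ; apply/mrank_indep/(indepS _ iS)/subsetIl.
- by rewrite /mrank -eS; exact: mrank_indep.
Qed.

(** A basis of [J] is extended to one of [J'] and then to one of the whole span, so that the same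
    coordinates serve both flats. *)
Lemma adapted_basis2 J J' : flat a [set: 'I_n] J -> flat a [set: 'I_n] J' ->
  J \subset J' -> exists S, exists t, adapted J S t /\ adapted J' S t.
Proof.
move=> fJ fJ' JJ'; have i0 : indep a set0 by rewrite /indep /image_mem enum_set0 nil_free.
have [B [_ BJ iB eB]] := indep_extend i0 (sub0set J).
have [B' [BB' B'J' iB' eB']] := indep_extend iB (subset_trans BJ JJ').
have [S [B'S _ iS eS]] := indep_extend iB' (subsetT B').
(* The dual form at [s] separates [a s] from the span of the other basis elements. *)
have /fin_all_exists[t tP] s : exists t : 'rV[F]_d, s \in S ->
    (forall y, y \in vspan a (S :\ s) -> (t *m y) 0 0 = 0) /\ form_at t s = 1.
  have [sS|_] := boolP (s \in S); last by exists 0.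
  by have [t t0 t1] := separating_form (indepD1 iS sS); exists t.
have td s s' : s \in S -> s' \in S -> form_at (t s) s' = (s == s')%:R.
  move=> sS s'S; have [t0 t1] := tP _ sS; have [<-//|ne] := eqVneq s s'.
  by apply: t0; rewrite vspan_mem // !inE eq_sym ne.
exists S, t; split; apply: adapted_intro => //.
  by rewrite (indep_flatI iS (subset_trans BB' B'S) BJ eB).
by rewrite (indep_flatI iS B'S B'J' eB').
Qed.

Lemma adapted_basis J : flat a [set: 'I_n] J -> exists S, exists t, adapted J S t.
Proof.
by move=> fJ; have [S [t [aJ _]]] := adapted_basis2 fJ fJ (subxx _); exists S, t.
Qed.

Section Adapted.
Variables (J S : {set 'I_n}) (t : 'I_n -> 'rV[F]_d).
Hypotheses (fJ : flat a [set: 'I_n] J) (aJ : adapted J S t).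

Lemma form_vspan0 s y : s \in S :\: J -> y \in vspan a J -> (t s *m y) 0 0 = 0.
Proof. by move=> sSJ; apply: form_vspan => j /(adapted_flat aJ); apply. Qed.

Lemma flat_expand i : i \in J ->
  a i = \sum_(s in S :&: J) form_at (t s) i *: a s.
Proof.
move=> iJ; rewrite {1}(adapted_expand aJ i) (big_setID J) /=.
rewrite [X in _ + X]big1 ?addr0 // => s sSJ.
by move/(adapted_flat aJ): iJ => ->; rewrite ?scale0r.
Qed.

Lemma not_flat_form e : e \notin J -> exists2 s, s \in S :\: J & form_at (t s) e != 0.
Proof.
move=> eJ; have [/existsP[s /andP[sS c0]]|] :=
  boolP [exists s, (s \in S :\: J) && (form_at (t s) e != 0)]; first by exists s.
rewrite negb_exists => /forallP h; case/negP: eJ; apply/(adapted_flat aJ) => s sS.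
by apply/eqP; move: (h s); rewrite sS negbK.
Qed.

Lemma adapted_span : vspan a S = vspan a [set: 'I_n].
Proof.
apply/eqP; rewrite eqEsubv vspanS ?subsetT //=.
apply/vspan_subvP => i _; rewrite (adapted_expand aJ i).
by apply: rpred_sum => s sS; rewrite rpredZ // vspan_mem.
Qed.

Lemma adapted_indep : indep a S.
Proof.
by rewrite /indep /free size_map -cardE -(adapted_card aJ) /mrank -adapted_span.
Qed.

Lemma coord_cover s : s \in S :\: J -> a s \notin vspan a J.
Proof. by case/setDP=> _ sJ; rewrite -(mem_flat fJ). Qed.

(** The form [t s] vanishes on [J] and at [x], hence on the span of [x |: J], which therefore misses
    [a y]. *)
Lemma closure_neq s x y : s \in S :\: J -> form_at (t s) x = 0 -> form_at (t s) y != 0 ->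
  closure a (x |: J) != closure a (y |: J).
Proof.
move=> sS sx sy; apply: contra sy => /eqP exy; apply/eqP.
apply: (@form_vspan _ (x |: J)) => [j /setU1P[->//|jJ]|].
  exact: (form_vspan0 sS (vspan_mem a jJ)).
by rewrite -closureP exy closureP vspan_mem ?setU11.
Qed.

Lemma closure_basis_inj : {in S :\: J &, injective (fun s => closure a (s |: J))}.
Proof.
move=> s s' sSJ s'SJ /eqP; apply: contraTeq => ne.
move: (sSJ) (s'SJ) => /setDP[sS _] /setDP[s'S _].
apply: (closure_neq s'SJ); rewrite (dual_form aJ) // ?eqxx ?oner_eq0 //.
by rewrite eq_sym (negPf ne).
Qed.

(** The elements of [S :\: J] already generate as many distinct covers as the corank of [J]. The
    cover generated by [e] is one more: for every basis element, one of the coordinates [s], [s']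
    vanishes there but not at [e]. *)
Lemma coords_nonbasic e s s' : s \in S :\: J -> s' \in S :\: J -> s != s' ->
  form_at (t s) e != 0 -> form_at (t s') e != 0 -> ~~ basic (contraction a J) (~: J).
Proof.
move=> sS s'S ne se s'e.
have eJ : a e \notin vspan a J.
  by apply: contra se => eJ; rewrite /form_at (form_vspan0 sS eJ).
have eS : closure a (e |: J) \notin [set closure a (r |: J) | r in S :\: J].
  apply/imsetP => -[r rS] /eqP; apply/negP; rewrite eq_sym.
  have [er|nr] := eqVneq r s.
    apply: (closure_neq s'S) => //; rewrite (dual_form aJ) ?er 1?eq_sym ?(negPf ne) //.
      by case/setDP: s'S.
    by case/setDP: sS.
  apply: (closure_neq sS) => //; rewrite (dual_form aJ) 1?eq_sym ?(negPf nr) //.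
    by case/setDP: sS.
  by case/setDP: rS.
have /subset_leq_card : closure a (e |: J) |: [set closure a (r |: J) | r in S :\: J]
    \subset covers a J.
  rewrite subUset sub1set closure1_covers //=; apply/subsetP => _ /imsetP[r rS ->].
  exact/closure1_covers/coord_cover.
rewrite cardsU1 eS (card_in_imset closure_basis_inj) add1n => lt.
rewrite basicE // (adapted_mrank aJ) (adapted_card aJ) -(cardsID J S).
by rewrite addnC eqn_add2l neq_ltn lt orbT.
Qed.

(** Otherwise each element outside [J] has a single nonzero coordinate outside [J], so it generates
    the same cover as a basis element, and the covers are exactly as many as the corank. *)
Lemma nonbasic_coords : ~~ basic (contraction a J) (~: J) ->
  exists e s s', [/\ s \in S :\: J, s' \in S :\: J, s != s',
    form_at (t s) e != 0 & form_at (t s') e != 0].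
Proof.
move=> nb; have [/existsP[e /existsP[s /existsP[s' /and5P[*]]]]|none] :=
  boolP [exists e, exists s, exists s', [&& s \in S :\: J, s' \in S :\: J, s != s',
    form_at (t s) e != 0 & form_at (t s') e != 0]]; first by exists e, s, s'.
have one e s s' : s \in S :\: J -> s' \in S :\: J -> s != s' ->
    form_at (t s) e != 0 -> form_at (t s') e = 0.
  move=> sS s'S ne c0; apply/eqP/negPn/negP => c0'; case/negP: none.
  apply/existsP; exists e; apply/existsP; exists s; apply/existsP; exists s'.
  by apply/and5P.
have coversE' : covers a J = [set closure a (s |: J) | s in S :\: J].
  apply/setP => G; apply/idP/imsetP => [GJ|[s sS ->]]; last exact/closure1_covers/coord_cover.
  move: (GJ); rewrite inE => /and3P[fG JG /eqP rG].
  have [|e eG eJ] := subsetPn (_ : ~~ (G \subset J)).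
    by apply/negP => GsJ; move: (dimvS (vspanS a GsJ)); rewrite -!/(mrank _ _) rG ltnn.
  have [s sS c0] := not_flat_form eJ; exists s => //.
  rewrite (coversE GJ eG) -?(mem_flat fJ) //; apply/esym.
  apply: (coversE (closure1_covers (coord_cover sS))); last by rewrite -(mem_flat fJ).
  rewrite closureP (adapted_expand aJ e); apply: rpred_sum => s' s'S.
  have [s'J|s'J] := boolP (s' \in J); first by rewrite rpredZ // vspan_mem // !inE s'J orbT.
  have [->|ne] := eqVneq s s'; first by rewrite rpredZ // vspan_mem // setU11.
  by rewrite (one e s s') // ?scale0r ?mem0v // inE s'J.
case/negP: nb; rewrite basicE // coversE' (card_in_imset closure_basis_inj).
by rewrite (adapted_mrank aJ) (adapted_card aJ) addnC cardsID.
Qed.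

End Adapted.

(* A non-basic contraction has an element with two nonzero coordinates outside J;
   contract all the other basis elements. *)
Lemma nonbasic_corank2 J : flat a [set: 'I_n] J ->
  ~~ basic (contraction a J) (~: J) ->
  exists J', [/\ flat a [set: 'I_n] J', J \subset J',
    ~~ basic (contraction a J') (~: J') & (mrank a J' + 2)%N = mrank a [set: 'I_n]].
Proof.
move=> fJ nb; have [S [t aJ]] := adapted_basis fJ.
have [e [s [s' [sSJ s'SJ ne se s'e]]]] := nonbasic_coords fJ aJ nb.
move: (sSJ) (s'SJ) => /setDP[sS sJ] /setDP[s'S s'J].
pose B := S :\: [set s; s']; pose J' := closure a B.
have iB : indep a B by apply: indepS (adapted_indep aJ); exact: subsetDl.
have rJ' : (mrank a J' + 2)%N = mrank a [set: 'I_n].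
  rewrite {1}/mrank vspan_closure -/(mrank a B) mrank_indep // (adapted_card aJ).
  rewrite -(cardsID [set s; s'] S) addnC; congr (_ + _)%N.
  have /setIidPr -> : [set s; s'] \subset S by rewrite subUset !sub1set sS.
  by rewrite cards2 ne.
have eJ' : S :&: J' = B.
  by apply: (indep_flatI (adapted_indep aJ)); rewrite ?vspan_closure ?sub_closure // subsetDl.
have fJ' : flat a [set: 'I_n] J' by exact: closure_flat.
have aJ' : adapted J' S t.
  apply: adapted_intro => //; [exact: dual_form aJ | exact: adapted_indep aJ | |].
    exact: adapted_span aJ.
  by rewrite eJ' vspan_closure.
have out r : r \in [set s; s'] -> r \in S -> r \in S :\: J'.
  move=> rss rS; rewrite inE rS andbT; apply/negP => inJ.
  have : r \in S :&: J' by rewrite inE rS.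
  by rewrite eJ' inE rss.
exists J'; split; [exact: fJ' | | | exact: rJ'].
  apply/subsetP => j jJ; rewrite closureP (flat_expand aJ jJ).
  apply: rpred_sum => r /setIP[rS rJ]; rewrite rpredZ // vspan_mem // !inE rS andbT.
  by rewrite negb_or; apply/andP; split; apply: contraTneq rJ => ->.
by apply: (coords_nonbasic fJ' aJ' _ _ ne se s'e); apply: out; rewrite // !inE eqxx ?orbT.
Qed.

(** By contraposition: in a basis adapted to both flats, an element with two nonzero coordinates
    outside [J'] has them outside [J] as well. *)
Lemma basicS J J' : flat a [set: 'I_n] J -> flat a [set: 'I_n] J' -> J \subset J' ->
  basic (contraction a J) (~: J) -> basic (contraction a J') (~: J').
Proof.
move=> fJ fJ' JJ'; apply: contraTT => nb; have [S [t [aJ aJ']]] := adapted_basis2 fJ fJ' JJ'.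
have [e [s [s' [sS s'S ne se s'e]]]] := nonbasic_coords fJ' aJ' nb.
by apply: (coords_nonbasic fJ aJ _ _ ne se s'e); [move: sS | move: s'S];
  apply/subsetP/setDS.
Qed.

(** Modulo the span of [J], a cover spans a line, generated by any of its elements outside [J]. *)
Lemma covers_proportional J G e i : flat a [set: 'I_n] J -> G \in covers a J ->
  e \in G -> e \notin J -> i \in G ->
  exists l, a i - l *: a e \in vspan a J.
Proof.
move=> fJ GJ eG eJ; rewrite {1}(coversE GJ eG) -?(mem_flat fJ) // closureP vspanU vspan1.
move=> /memv_addP[_ /vlineP[l ->] [y yJ ->]]; exists l.
by rewrite addrAC subrr add0r.
Qed.

End AdaptedBasis.

From mathcomp Require Import boolp classical_sets reals complex mpoly.
From mathcomp Require Import ring.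

Local Open Scope classical_set_scope.

(** * Zariski closed sets and chains *)

Section Zariski.
Variables (K : closedFieldType) (n : nat).
Implicit Types (S X Y Z : set 'rV[K]_n) (p : 'rV[K]_n) (f g : {mpoly K[n]}).

Lemma sub_zclosure S : S `<=` zariski_closure S.
Proof. by move=> p Sp f; apply. Qed.

Lemma vanishing_zclosure S : vanishing_ideal (zariski_closure S) = vanishing_ideal S.
Proof.
apply/seteqP; split => f fS p; last by apply.
by move/sub_zclosure; exact: fS.
Qed.

Lemma zclosure_closed S : zariski_closed (zariski_closure S).
Proof. by rewrite /zariski_closed {1}/zariski_closure vanishing_zclosure. Qed.

Lemma zclosureS S Y : S `<=` Y -> zariski_closure S `<=` zariski_closure Y.
Proof. by move=> SY p pS f fY; apply: pS => q /SY; exact: fY. Qed.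

Lemma zclosure_sub S Z : zariski_closed Z -> S `<=` Z -> zariski_closure S `<=` Z.
Proof. by move=> cZ /zclosureS; rewrite cZ. Qed.

Lemma zclosedP Z : (forall p, ~ Z p -> exists2 f, vanishing_ideal Z f & f.@[p 0] <> 0) ->
  zariski_closed Z.
Proof.
move=> h; apply/seteqP; split; last exact: sub_zclosure.
by move=> p pZ; apply: contrapT => /h[f /pZ].
Qed.

Lemma zclosed_sep Z p : zariski_closed Z -> ~ Z p ->
  exists2 f, vanishing_ideal Z f & f.@[p 0] != 0.
Proof.
move=> cZ; rewrite -{1}cZ => /existsNP[f /not_implyP[fZ /eqP fp]].
by exists f.
Qed.

Lemma zclosed_zeros Y (P : set {mpoly K[n]}) : zariski_closed Y ->
  zariski_closed [set p | Y p /\ forall f, P f -> f.@[p 0] = 0].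
Proof.
move=> cY; apply: zclosedP => p /not_andP[|/existsNP[f /not_implyP[Pf fp]]].
  by move=> /(zclosed_sep cY)[f fY /eqP fp]; exists f => // q [/fY].
by exists f => // q [_]; apply.
Qed.

Lemma zclosed1 p : zariski_closed [set p].
Proof.
apply: zclosedP => q qp; have [i /eqP ne] : exists i, q 0 i <> p 0 i.
  by apply/existsNP => h; apply: qp; apply/matrixP => i j; rewrite ord1.
exists ('X_i - (p 0 i)%:MP) => [_ ->|]; first by rewrite mevalB mevalXU mevalC subrr.
by apply/eqP; rewrite mevalB mevalXU mevalC subr_eq0.
Qed.

Section FiniteUnion.
Variables (T : finType) (D : set T) (Y : T -> set 'rV[K]_n).
Hypothesis cY : forall J, D J -> zariski_closed (Y J).

Lemma zclosed_bigcup : zariski_closed (\bigcup_(J in D) Y J).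
Proof.
apply: zclosedP => p np.
(* The default 1 outside [D] keeps the product over all of [T] nonzero at [p]. *)
have /fin_all_exists2[f fY fp] J : exists2 f, D J -> vanishing_ideal (Y J) f & f.@[p 0] != 0.
  have [DJ|nDJ] := pselect (D J); last by exists 1; rewrite ?meval1 ?oner_eq0.
  have [|f fY fp] := zclosed_sep (cY DJ) (_ : ~ Y J p); last by exists f.
  by move=> pJ; apply: np; exists J.
exists (\prod_J f J) => [q [J DJ qJ]|]; rewrite rmorph_prod /=.
  by rewrite (bigD1 J) //= fY // mul0r.
by apply/eqP/prodf_neq0.
Qed.

End FiniteUnion.

(** [Z] is the union of its zero loci of [f] and of [g], so it equals one of them. *)
Lemma irreducible_prime Z f g : irreducible_closed Z -> vanishing_ideal Z (f * g) ->
  vanishing_ideal Z f \/ vanishing_ideal Z g.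
Proof.
move=> [cZ _ irr] fg.
pose V h := [set p | Z p /\ forall k, [set h] k -> k.@[p 0] = 0].
have cV h : zariski_closed (V h) by exact: zclosed_zeros.
have [|eZ|eZ] := irr (V f) (V g) (cV _) (cV _).
- apply/seteqP; split => [p Zp|p [] []//]; move/eqP: (fg _ Zp).
  by rewrite mevalM mulf_eq0 => /orP[] /eqP h; [left|right]; split => // _ ->.
- by left => p; rewrite {1}eZ => -[_]; apply.
- by right => p; rewrite {1}eZ => -[_]; apply.
Qed.

Lemma irreducible_prime_prod Z (T : Type) (r : seq T) (f : T -> {mpoly K[n]}) :
  irreducible_closed Z -> vanishing_ideal Z (\prod_(J <- r) f J) ->
  exists J, vanishing_ideal Z (f J).
Proof.
move=> iZ; elim: r => [|J r IH]; last first.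
  by rewrite big_cons => /(irreducible_prime iZ)[|/IH //]; exists J.
case: iZ => _ [p Zp] _; rewrite big_nil => /(_ _ Zp) /eqP.
by rewrite meval1 oner_eq0.
Qed.

(** If [Z] were in no [Y J], each [J] would give a polynomial vanishing on [Y J] but not on [Z];
    their product vanishes on [Z], against primality. *)
Lemma irreducible_sub_bigcup (T : finType) (D : set T) (Y : T -> set 'rV[K]_n) Z :
  (forall J, D J -> zariski_closed (Y J)) -> irreducible_closed Z ->
  Z `<=` \bigcup_(J in D) Y J -> exists2 J, D J & Z `<=` Y J.
Proof.
move=> cY iZ sub; apply: contrapT => none.
have /fin_all_exists2[f fY fZ] J : exists2 f, D J -> vanishing_ideal (Y J) f &
    ~ vanishing_ideal Z f.
  have [DJ|nDJ] := pselect (D J); last first.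
    case: (iZ) => _ [p Zp] _; exists 1 => // /(_ _ Zp) /eqP.
    by rewrite meval1 oner_eq0.
  have [p /not_implyP[Zp nY]] : exists p, ~ (Z p -> Y J p).
    by apply/existsNP => h; apply: none; exists J.
  by have [f fJ /eqP fp] := zclosed_sep (cY _ DJ) nY; exists f => // /(_ _ Zp).
have [|J /fZ //] := @irreducible_prime_prod Z _ (index_enum T) f iZ.
move=> p /sub[J DJ pJ]; rewrite rmorph_prod /= (bigD1 J) //= fY //.
by rewrite mul0r.
Qed.

(** Naming both ends makes chains composable, which [irreducible_chain] alone does not show. *)
Definition chain_from_to X Z Z' k :=
  exists C, [/\ irreducible_chain X C k, C 0%N = Z & C k = Z'].

Lemma chain_refl X Z : irreducible_closed Z -> Z `<=` X -> chain_from_to X Z Z 0.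
Proof. by move=> iZ ZX; exists (fun=> Z); split=> //; split=> i; rewrite ?ltn0. Qed.

Lemma chain_trans X Z1 Z2 Z3 k l : chain_from_to X Z1 Z2 k ->
  chain_from_to X Z2 Z3 l -> chain_from_to X Z1 Z3 (k + l).
Proof.
move=> [C [[Ci Cs] C0 Ck]] [C' [[Ci' Cs'] C0' Cl']].
exists (fun i => if (i <= k)%N then C i else C' (i - k)%N); split => //.
- split => i ik.
    case: (leqP i k) => [lik|_]; first exact: Ci.
    by apply: Ci'; rewrite leq_subLR.
  case: (ltngtP i k) => [ltik|ltki|eik].
  + exact: Cs.
  + rewrite subSn; last exact: ltnW.
    by apply: Cs'; rewrite ltn_subLR // ltnW.
  + by rewrite eik subSnn Ck -C0'; apply: Cs'; rewrite -(ltn_add2l k) addn0 -{1}eik.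
(* The index [k + l] falls into the first branch only when [l] is 0, and then both chains meet
   there. *)
- case: leqP; last by rewrite addKn.
  rewrite -{2}[k]addn0 leq_add2l leqn0 => /eqP l0.
  by rewrite l0 addn0 Ck -C0' -Cl' l0.
Qed.

Lemma chain_step X Z Z' : irreducible_closed Z -> irreducible_closed Z' ->
  Z `<` Z' -> Z' `<=` X -> chain_from_to X Z Z' 1.
Proof.
move=> iZ iZ' lt ZX; exists (fun i => if i is 0 then Z else Z'); split => //.
split => [[|i] _|[|i]] //; split => //.
by apply: subset_trans ZX; case: lt.
Qed.

Lemma has_codim_unique X Z c c' : has_codim Z X c -> has_codim Z X c' -> c = c'.
Proof.
move=> [[C hC C0] ub] [[C' hC' C0'] ub']; apply/eqP; rewrite eqn_leq.
by rewrite (ub' C) // (ub C').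
Qed.

End Zariski.

(** * Germs of rational curves *)

Lemma mpoly_ring_ind (K : comNzRingType) n (P : {mpoly K[n]} -> Prop) :
  (forall c, P c%:MP) -> (forall i, P 'X_i) ->
  (forall f g, P f -> P g -> P (f + g)) -> (forall f g, P f -> P g -> P (f * g)) ->
  forall f, P f.
Proof.
move=> PC PX PD PM f; have PXm m : P 'X_[m].
  rewrite mpolyXE_id; apply: big_ind => [|//|i _]; first by rewrite -mpolyC1.
  elim: (m i) => [|k IH]; first by rewrite expr0 -mpolyC1.
  by rewrite exprS; exact: PM.
elim/mpolyind: f => [|c m f _ _ Pf]; first by rewrite -mpolyC0.
by apply: PD => //; rewrite -mul_mpolyC; exact: PM.
Qed.

Section DirectionalDerivative.
Variables (K : closedFieldType) (n : nat) (p v : 'I_n -> K).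
Implicit Types (f g : {mpoly K[n]}).

(** The sum has the shape used in [tangent_space], so tangency is the vanishing of [dirderiv] on the
    ideal. *)
Definition dirderiv f := \sum_(i < n) (mderiv i f).@[p] * v i.

Lemma dirderivC c : dirderiv c%:MP = 0.
Proof. by rewrite /dirderiv big1 // => i _; rewrite mderivC meval0 mul0r. Qed.

Lemma dirderivX i : dirderiv 'X_i = v i.
Proof.
rewrite /dirderiv (bigD1 i) //= big1 ?addr0 => [|j ne]; rewrite mderivX mevalZ mnm1E.
  have -> : (U_(i) - U_(i))%MM = 0%MM by apply/mnmP => j; rewrite mnmBE subnn mnm0E.
  by rewrite eqxx mpolyX0 meval1 !mul1r.
by rewrite eq_sym (negPf ne) !mul0r.
Qed.

Lemma dirderivD f g : dirderiv (f + g) = dirderiv f + dirderiv g.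
Proof.
by rewrite /dirderiv -big_split /=; apply: eq_bigr => i _; rewrite mderivD mevalD mulrDl.
Qed.

Lemma dirderivM f g : dirderiv (f * g) = dirderiv f * g.@[p] + f.@[p] * dirderiv g.
Proof.
rewrite /dirderiv mulr_suml mulr_sumr -big_split /=; apply: eq_bigr => i _.
by rewrite mderivM mevalD !mevalM; ring.
Qed.

Lemma dirderivZ c f : dirderiv (c *: f) = c * dirderiv f.
Proof. by rewrite -mul_mpolyC dirderivM dirderivC mul0r add0r mevalC. Qed.

Lemma dirderivB f g : dirderiv (f - g) = dirderiv f - dirderiv g.
Proof. by rewrite -scaleN1r dirderivD dirderivZ mulN1r. Qed.

Lemma dirderiv_sum (I : Type) (r : seq I) (P : pred I) (F : I -> {mpoly K[n]}) :
  dirderiv (\sum_(i <- r | P i) F i) = \sum_(i <- r | P i) dirderiv (F i).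
Proof. by apply: (big_morph _ dirderivD); rewrite -mpolyC0 dirderivC. Qed.

End DirectionalDerivative.

Section Germs.
Variable K : closedFieldType.
Implicit Types (g h : K -> K) (D Q R : {poly K}).

Let hornerS := (@hornerD K, @hornerN K, @hornerM K, @hornerZ K, @hornerC K,
  @hornerX K, @hornerXn K).

(* g is a rational function, regular at 0, with first order expansion a + b s;
   its values at the poles are arbitrary. *)
Definition germ g (a b : K) := exists D, exists Q, D.[0] != 0 /\
  forall s, D.[s] != 0 -> D.[s] * g s = D.[s] * (a + b * s) + s ^+ 2 * Q.[s].

Lemma germ_cst c : germ (fun=> c) c 0.
Proof.
exists 1, 0; rewrite hornerC oner_eq0; split=> // s _.
by rewrite !hornerC; ring.
Qed.

Lemma germ_id : germ id 0 1.
Proof.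
exists 1, 0; rewrite hornerC oner_eq0; split=> // s _.
by rewrite !hornerC; ring.
Qed.

Lemma germD g h a b a' b' : germ g a b -> germ h a' b' ->
  germ (fun s => g s + h s) (a + a') (b + b').
Proof.
move=> [D [Q [D0 e]]] [D' [Q' [D'0 e']]]; exists (D * D'), (D' * Q + D * Q').
rewrite hornerM mulf_neq0 //; split=> // s; rewrite hornerM mulf_eq0 negb_or => /andP[Ds D's].
rewrite hornerD !hornerM.
transitivity (D'.[s] * (D.[s] * g s) + D.[s] * (D'.[s] * h s)); first by ring.
by rewrite e // e' //; ring.
Qed.

Lemma germM g h a b a' b' : germ g a b -> germ h a' b' ->
  germ (fun s => g s * h s) (a * a') (a * b' + b * a').
Proof.
move=> [D [Q [D0 e]]] [D' [Q' [D'0 e']]].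
exists (D * D'), (b * b' *: (D * D') + D * Q' * (a%:P + b *: 'X) +
  D' * Q * (a'%:P + b' *: 'X) + 'X^2 * Q * Q').
rewrite hornerM mulf_neq0 //; split=> // s; rewrite hornerM mulf_eq0 negb_or => /andP[Ds D's].
rewrite !hornerS.
transitivity ((D.[s] * g s) * (D'.[s] * h s)); first by ring.
by rewrite e // e' //; ring.
Qed.

Lemma germV g a b : a != 0 -> germ g a b -> germ (fun s => (g s)^-1) a^-1 (- b / a ^+ 2).
Proof.
move=> a0 [D [Q [D0 e]]].
pose N := D * (a%:P + b *: 'X) + 'X^2 * Q.
have NE s : N.[s] = D.[s] * (a + b * s) + s ^+ 2 * Q.[s] by rewrite !hornerS; ring.
(* The remainder comes from (a + b s)(1/a - b s / a^2) = 1 - (b s / a)^2, with [N] equal to [D]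
   times g. *)
clearbody N; exists (D * N), (D * ((b / a) ^+ 2 *: D - Q * (a^-1%:P - b / a ^+ 2 *: 'X))); split.
  by rewrite hornerM NE expr0n mul0r mulr0 !addr0 !mulf_neq0.
move=> s; rewrite hornerM mulf_eq0 negb_or => /andP[Ds Ns].
have gs : D.[s] * g s = N.[s] by rewrite NE e.
have -> : (g s)^-1 = D.[s] / N.[s].
  rewrite -gs invfM mulrA divff ?mul1r //.
transitivity (D.[s] ^+ 2); first by field.
by rewrite !hornerS NE; field.
Qed.

Lemma poly_eq0 (P : {poly K}) : (forall s, P.[s] = 0) -> P = 0.
Proof.
move=> P0; apply/eqP/negPn/negP => /closed_nonrootP[x]; rewrite /root P0.
by rewrite eqxx.
Qed.

(** The polynomial [P], which is [D] times g away from the zeros of [D], vanishes wherever [R * D]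
    does not, so it is zero. Its two lowest coefficients then give a = 0 and b = 0 in turn, as [D]
    is nonzero at 0. *)
Lemma germ_zero g a b R : germ g a b -> R != 0 ->
  (forall s, R.[s] != 0 -> g s = 0) -> a = 0 /\ b = 0.
Proof.
move=> [D [Q [D0 e]]] R0 g0.
pose P := D * (a%:P + b *: 'X) + 'X^2 * Q.
have Dn0 : D != 0 by apply: contraNneq D0 => ->; rewrite horner0.
have P0 : P = 0.
  have /eqP : P * (R * D) = 0.
    apply: poly_eq0 => s; rewrite !hornerM.
    have [->|Rs] := eqVneq R.[s] 0; first by rewrite mul0r mulr0.
    have [->|Ds] := eqVneq D.[s] 0; first by rewrite !mulr0.
    have -> : P.[s] = D.[s] * g s by rewrite e // !hornerS; ring.
    by rewrite g0 // mulr0 mul0r.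
  by rewrite !mulf_eq0 (negPf R0) (negPf Dn0) !orbF => /eqP.
have a0 : a = 0.
  have /eqP : P.[0] = 0 by rewrite P0 horner0.
  by rewrite /P !hornerS !(mulr0, mul0r, addr0, expr0n) mulf_eq0 (negPf D0) /= => /eqP.
split=> //; move: P0; have -> : P = 'X * (b *: D + 'X * Q).
  rewrite /P a0 polyC0 add0r mulrDr expr2 mulrA; congr (_ + _).
  by rewrite -scalerAr -scalerAr mulrC.
move/eqP; rewrite mulf_eq0 polyX_eq0 /= => /eqP Q0.
have /eqP : (b *: D + 'X * Q).[0] = 0 by rewrite Q0 horner0.
by rewrite !hornerS !(mulr0, mul0r, addr0, expr0n) mulf_eq0 (negPf D0) orbF => /eqP.
Qed.

Lemma germ_neq0 g a b : germ g a b -> a != 0 ->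
  exists2 R, R.[0] != 0 & forall s, R.[s] != 0 -> g s != 0.
Proof.
move=> [D [Q [D0 e]]] a0; exists (D * (D * (a%:P + b *: 'X) + 'X^2 * Q)).
  by rewrite !hornerS !(mulr0, mul0r, addr0, expr0n) !mulf_neq0.
move=> s; rewrite hornerM mulf_eq0 negb_or => /andP[Ds].
have -> : (D * (a%:P + b *: 'X) + 'X^2 * Q).[s] = D.[s] * g s.
  by rewrite e // !hornerS; ring.
by rewrite mulf_eq0 negb_or => /andP[].
Qed.

(** This is the chain rule to first order, proved on ring generators and propagated through sums and
    products. *)
Lemma germ_meval n (f : {mpoly K[n]}) (c : 'I_n -> K -> K) (p v : 'I_n -> K) :
  (forall i, germ (c i) (p i) (v i)) ->
  germ (fun s => f.@[c ^~ s]) f.@[p] (dirderiv p v f).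
Proof.
move=> hc; elim/mpoly_ring_ind: f => [k|i|f g hf hg|f g hf hg].
- by under eq_fun do rewrite mevalC; rewrite mevalC dirderivC; exact: germ_cst.
- by under eq_fun do rewrite mevalXU; rewrite mevalXU dirderivX.
- by under eq_fun do rewrite mevalD; rewrite mevalD dirderivD; exact: germD.
- under eq_fun do rewrite mevalM; rewrite mevalM dirderivM addrC.
  exact: germM.
Qed.

End Germs.

(** * Length of chains *)

Section ChainMonomials.
Variables (K : closedFieldType) (n m : nat) (h : nat -> {mpoly K[n]}).

(** Exponent vectors of length [k] with entries below [m], as iterated pairs so that the last
    exponent is split off by projection. *)
Fixpoint exponents k : finType :=
  if k is k'.+1 then ((exponents k' * 'I_m)%type : finType) else unit : finType.

Fixpoint monomial k : exponents k -> {mpoly K[n]} :=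
  if k is k'.+1 then fun a => monomial a.1 * h k' ^+ (a.2 : 'I_m) else fun=> 1.

Lemma card_exponents k : #|exponents k| = (m ^ k)%N.
Proof.
elim: k => [|k IH]; first by rewrite card_unit.
by rewrite expnSr card_prod IH card_ord.
Qed.

(* In a vanishing linear combination of monomials on C k.+1, the lowest power
   of h k can be cancelled since the ideal is prime; restricting to C k, where
   h k vanishes, then removes all other powers. *)
Lemma monomials_free (C : nat -> set 'rV[K]_n) k :
  (forall i, (i <= k)%N -> irreducible_closed (C i)) ->
  (forall i, (i < k)%N -> C i `<=` C i.+1 /\ vanishing_ideal (C i) (h i) /\
     ~ vanishing_ideal (C i.+1) (h i)) ->
  forall c : exponents k -> K,
    vanishing_ideal (C k) (\sum_a c a *: monomial a) -> forall a, c a = 0.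
Proof.
elim: k => [|k IH] iC hC c.
  have [_ [p Cp] _] := iC 0%N isT; move=> /(_ _ Cp); rewrite (bigD1 tt) //= big1.
    by rewrite addr0 mevalZ meval1 mulr1 => c0 [].
  by case.
move=> c0; have [sub [hk nhk]] := hC k (ltnSn k).
pose G (j : 'I_m) : {mpoly K[n]} := \sum_a c (a, j) *: monomial a.
have cG : \sum_a c a *: monomial a = \sum_j G j * h k ^+ j.
  rewrite (eq_bigr (fun a => c (a.1, a.2) *: (monomial a.1 * h k ^+ a.2))); last by case.
  rewrite -(pair_bigA _ (fun a j => c (a, j) *: (monomial a * h k ^+ j))) exchange_big.
  by apply: eq_bigr => j _; rewrite mulr_suml; apply: eq_bigr => a _; rewrite scalerAl.
rewrite {}cG in c0; suff cj (j : 'I_m) a : c (a, j) = 0 by case.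
have [l jl] : exists l, (j = l :> nat) by exists j.
elim/ltn_ind: l j jl a => l IHl j jl; apply: IH => [i ik|i ik|].
- exact/iC/leqW.
- exact/hC/leqW.
pose R := \sum_(i : 'I_m | (j <= i)%N) G i * h k ^+ (i - j).
have eR : \sum_(i < m) G i * h k ^+ i = h k ^+ j * R.
  rewrite (bigID (fun i : 'I_m => (j <= i)%N)) /= [X in _ + X]big1 ?addr0.
    rewrite mulr_sumr; apply: eq_bigr => i ji.
    by rewrite mulrCA -exprD subnKC.
  move=> i; rewrite -ltnNge jl => il; rewrite /G big1 ?mul0r // => a _.
  by rewrite (IHl i) ?scale0r.
rewrite {}eR in c0.
have [hj0|R0] := irreducible_prime (iC k.+1 (leqnn _)) c0.
  case: nhk => p Cp; have /eqP := hj0 _ Cp.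
  by rewrite rmorphXn expf_eq0 => /andP[_ /eqP].
move=> p Cp; have := R0 _ (sub _ Cp); rewrite /R rmorph_sum (bigD1 j) //= subnn expr0 mulr1.
rewrite big1 ?addr0 // => i /andP[ji ne]; rewrite mevalM rmorphXn /= hk // expr0n.
have ltji : (j < i)%N.
  by rewrite ltn_neqAle ji andbT; apply: contraNneq ne => /val_inj ->.
by rewrite subn_eq0 leqNgt ltji mulr0.
Qed.

End ChainMonomials.

(** * Dimension bound by clearing denominators and counting monomials *)

Section DimensionBound.
Variables (K : closedFieldType) (d n : nat) (B : 'M[K]_(d, n)).
Implicit Types (f g : {mpoly K[n]}) (q : {mpoly K[d]}) (t : 'rV[K]_d).

Let u (t : 'rV[K]_d) i := (t *m B) 0 i.

(* q is the polynomial obtained from f(1 / u) by clearing denominators. *)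
Definition clears E f q := (msize q <= (n * E).+1)%N /\
  forall t, (forall i, u t i != 0) ->
    q.@[t 0] = (\prod_i u t i) ^+ E * f.@[fun i => (u t i)^-1].

Lemma msizeM_leq q q' a b : (msize q <= a.+1)%N -> (msize q' <= b.+1)%N ->
  (msize (q * q') <= (a + b).+1)%N.
Proof.
move=> qa qb; have [->|q0] := eqVneq q 0; first by rewrite mul0r msize0.
have [->|q'0] := eqVneq q' 0; first by rewrite mulr0 msize0.
rewrite msizeM // -subn1 leq_subLR.
have -> : (1 + (a + b).+1 = a.+1 + b.+1)%N by rewrite add1n addSn addnS.
exact: leq_add.
Qed.

Let lin i : {mpoly K[d]} := \sum_j B j i *: 'X_j.

Lemma meval_lin t i : (lin i).@[t 0] = u t i.
Proof.
rewrite /lin rmorph_sum /u mxE; apply: eq_bigr => j _ /=.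
by rewrite mevalZ mevalXU mulrC.
Qed.

Lemma msize_lin i : (msize (lin i) <= 2)%N.
Proof.
apply: leq_trans (msize_sum _ _ _) _; apply/bigmax_leqP => j _.
by apply: leq_trans (msizeZ_le _ _) _; rewrite msizeX mdeg1.
Qed.

Lemma msize_prod_lin (P : pred 'I_n) : (msize (\prod_(i | P i) lin i) <= n.+1)%N.
Proof.
have : (msize (\prod_(i | P i) lin i) <= (\sum_(i | P i) 1).+1)%N.
  elim/big_rec2: _ => [|i k q _ IH]; first by rewrite msize1.
  by apply: msizeM_leq => //; exact: msize_lin.
move/leq_trans; apply; rewrite ltnS sum1_card -[X in (_ <= X)%N](card_ord n).
exact: max_card.
Qed.

Let U := \prod_i lin i.

Lemma meval_U t : U.@[t 0] = \prod_i u t i.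
Proof. by rewrite rmorph_prod; apply: eq_bigr => i _; exact: meval_lin. Qed.

Lemma clearsM E E' f f' q q' : clears E f q -> clears E' f' q' ->
  clears (E + E') (f * f') (q * q').
Proof.
move=> [dq eq] [dq' eq']; split=> [|t ut]; first by rewrite mulnDr; exact: msizeM_leq.
by rewrite !mevalM eq // eq' // exprD mulrACA.
Qed.

(** Multiplication by powers of [U] brings cleared forms to a common exponent. *)
Lemma clears_pad E : clears E 1 (U ^+ E).
Proof.
elim: E => [|E IH].
  by split=> [|t _]; rewrite expr0 ?meval1 ?mulr1 // msize1.
rewrite -addn1 exprD expr1 -[X in clears _ X _]mulr1; apply: clearsM => //; split=> [|t _].
  by rewrite muln1 msize_prod_lin.
by rewrite meval1 mulr1 expr1 meval_U.
Qed.

Lemma clears_weak E E' f q : (E <= E')%N -> clears E f q -> exists q', clears E' f q'.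
Proof.
move=> le cq; exists (q * U ^+ (E' - E)); rewrite -[f]mulr1 -(subnKC le) addKn.
exact: clearsM (clears_pad _).
Qed.

Lemma clearsD E f f' q q' : clears E f q -> clears E f' q' -> clears E (f + f') (q + q').
Proof.
move=> [dq eq] [dq' eq']; split=> [|t ut]; last by rewrite !mevalD eq // eq' // mulrDr.
by apply: leq_trans (msizeD_le _ _) _; rewrite geq_max dq.
Qed.

Lemma clears_ex f : exists E q, clears E f q.
Proof.
elim/mpoly_ring_ind: f => [c|i|f g|f g].
- exists 0%N, c%:MP; split=> [|t _]; first by rewrite msizeC muln0 leq_b1.
  by rewrite !mevalC expr0 mul1r.
(* The product of all linear forms times 1 / u_i is the product of the others. *)
- exists 1%N, (\prod_(j | j != i) lin j); split=> [|t ut].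
    by rewrite muln1 msize_prod_lin.
  rewrite mevalXU expr1 [in RHS](bigD1 i) //= mulrAC divff // mul1r rmorph_prod.
  by apply: eq_bigr => j _; exact: meval_lin.
- move=> [E [q cf]] [E' [q' cg]].
  have [q1 cf1] := clears_weak (leq_addr E' E) cf.
  have [q2 cg2] := clears_weak (leq_addl E E') cg.
  by exists (E + E')%N, (q1 + q2); exact: clearsD.
- by move=> [E [q cf]] [E' [q' cg]]; exists (E + E')%N, (q * q'); exact: clearsM.
Qed.

Lemma clears_exp E f q k : clears E f q -> clears (E * k) (f ^+ k) (q ^+ k).
Proof.
move=> cf; elim: k => [|k IH]; first by rewrite muln0; exact: clears_pad.
by rewrite mulnS !exprS; exact: clearsM.
Qed.

(** Exponents stay below [m], so one power of the denominator, linear in [m], clears all the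
    monomials at once. *)
Lemma clears_monomial m h (E : nat -> nat) k :
  (forall i, exists q, clears (E i) (h i) q) ->
  forall a : exponents m k, exists q, clears (m * \sum_(i < k) E i) (monomial h a) q.
Proof.
move=> hE; elim: k => [a|k IH [a j]].
  by exists (U ^+ 0); rewrite big_ord0 muln0; exact: clears_pad.
have [q cq] := IH a; have [r cr] := hE k.
rewrite big_ord_recr mulnDr; apply: (clears_weak _ (clearsM cq (clears_exp j cr))).
by rewrite leq_add2l mulnC leq_mul2r ltnW ?orbT.
Qed.

Lemma card_bmultinom N : (#|{: 'X_{1..d < N.+1}}| <= N.+1 ^ d)%N.
Proof.
rewrite -[X in (_ <= X ^ _)%N](card_ord N.+1) -[X in (_ <= _ ^ X)%N](card_ord d).
rewrite -card_ffun; pose f (m : 'X_{1..d < N.+1}) : {ffun 'I_d -> 'I_N.+1} :=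
  [ffun i => inord ((m : 'X_{1..d}) i)].
apply: (@leq_card _ _ f) => m1 m2 /ffunP eqf.
have small (m : 'X_{1..d < N.+1}) i : ((m : 'X_{1..d}) i < N.+1)%N.
  by apply: leq_ltn_trans (bmdeg m); rewrite mdegE (bigD1 i) //= leq_addr.
apply: val_inj; apply/mnmP => i; have := eqf i; rewrite !ffunE => /(congr1 val).
by rewrite /= !inordK.
Qed.

Definition reciprocals :=
  [set p : 'rV[K]_n | exists t, (forall i, u t i != 0) /\ p = \row_i (u t i)^-1].

(** The [m ^ k] monomials in the polynomials separating successive members of the chain become, once
    cleared, polynomials in [d] variables of degree at most linear in [m]. For [k > d] and large [m]
    they are too many to be independent, against [monomials_free]. *)
Lemma chain_length_reciprocals C k :
  irreducible_chain (zariski_closure reciprocals) C k -> (k <= d)%N.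
Proof.
move=> [iC sC]; rewrite leqNgt; apply/negP => ltdk.
have hex i : exists f, (i < k)%N -> vanishing_ideal (C i) f /\ ~ vanishing_ideal (C i.+1) f.
  have [ik|nik] := ltnP i k; last by exists 0.
  have [_ /existsNP[p /not_implyP[Cp nCp]]] := sC _ ik.
  have [cC _ _] := (iC i (ltnW ik)).1.
  have [f fC /eqP fp] := zclosed_sep cC nCp; exists f => _; split=> // /(_ p Cp).
  exact: fp.
have {hex}[h hP] := choice hex.
have [E hE] := choice (fun i => clears_ex (h i)).
(* With [N] as below, N + 1 is at most c m, so there are at most c^d m^d monomials of degree at most
   [N]; this is less than m^(d+1) because m exceeds c^d. *)
pose c := (n * \sum_(i < k) E i).+1; pose m := (c ^ d).+1.
have [q hq] := fin_all_exists (clears_monomial (m := m) hE (k := k)).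
pose N := (n * (m * \sum_(i < k) E i))%N.
pose T : finType := {: 'X_{1..d < N.+1}}.
have lt : (#|T| < #|exponents m k|)%N.
  apply: leq_ltn_trans (card_bmultinom _) _.
  have leX x y : (x <= y)%N -> (x ^ d <= y ^ d)%N.
    by case: (posnP d) => [->|d0]; rewrite ?expn0 ?leq_exp2r.
  apply: (@leq_ltn_trans ((c * m) ^ d)%N).
    apply: leX; rewrite /N /c mulnCA mulSn addnC -addn1 mulnC.
    by rewrite leq_add2l.
  rewrite card_exponents expnMn; apply: (@leq_trans (m ^ d.+1)).
    by rewrite expnS ltn_pmul2r ?expn_gt0.
  by rewrite leq_pexp2l.
(* Rows are the coefficient vectors of the cleared monomials; having more rows than columns forces a
   nontrivial relation. *)
pose M : 'M[K]_(#|exponents m k|, #|T|) :=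
  \matrix_(i, j) (q (enum_val i))@_(enum_val j : 'X_{1..d < N.+1}).
have : kermx M != 0.
  rewrite kermx_eq0 /row_free neq_ltn; apply/orP; left.
  by apply: leq_ltn_trans lt; exact: rank_leq_col.
move=> /rowV0Pn[v /sub_kermxP vM v0].
pose w a := v 0 (enum_rank a).
have Q0 : \sum_a w a *: q a = 0.
  apply/mpolyP => x; rewrite mcoeff0 linear_sum /=.
  have [xN|xN] := ltnP (mdeg x) N.+1; last first.
    apply: big1 => a _; rewrite linearZ /= memN_msupp_eq0 ?mulr0 //.
    by apply: msize_mdeg_ge; apply: leq_trans xN; exact: (hq a).1.
  have := congr1 (fun Y : 'rV_ _ => Y 0 (enum_rank (BMultinom xN : T))) vM.
  rewrite !mxE => M0; apply: etrans M0; rewrite [RHS](reindex (@enum_rank _)) /=.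
    by apply: eq_bigr => a _; rewrite mxE !enum_rankK linearZ.
  exact/onW_bij/enum_rank_bij.
case/eqP: v0; apply/rowP => i; rewrite mxE.
suff w0 a : w a = 0 by rewrite -(w0 (enum_val i)) /w enum_valK.
move: a; apply: (monomials_free (h := h) (C := C)).
- by move=> j jk; exact: (iC j jk).1.
- by move=> j jk; split; [exact: (sC j jk).1 | exact: hP].
suff: vanishing_ideal (zariski_closure reciprocals) (\sum_a w a *: monomial h a).
  by move=> van p /(iC k (leqnn _)).2; exact: van.
rewrite vanishing_zclosure => _ [t [ut ->]].
(* Dividing by the common denominator power turns the relation between cleared forms into one
   between the monomials on the reciprocals. *)
have U0 : (\prod_i u t i) ^+ (m * \sum_(i < k) E i) != 0.
  by apply: expf_neq0; apply/prodf_neq0.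
apply: (mulfI U0); rewrite mulr0 -[RHS](meval0 (t 0)) -Q0 !rmorph_sum mulr_sumr /=.
apply: eq_bigr => a _; rewrite !mevalZ mulrCA (hq a).2 //; congr (_ * (_ * _)).
by apply: meval_eq => j; rewrite mxE.
Qed.

End DimensionBound.

(** * Limits and irreducibility along curves *)

Section Curves.
Variables (K : closedFieldType) (n : nat).
Implicit Types (S : set 'rV[K]_n) (c : 'I_n -> K -> K) (R : {poly K}).

(** Along the curve a polynomial vanishing on [S] is a germ that is zero at all but finitely many
    parameters, so by [germ_zero] its value and its derivative at 0 both vanish. *)
Lemma curve_limit S c (p v : 'I_n -> K) R : (forall i, germ (c i) (p i) (v i)) -> R != 0 ->
  (forall s, R.[s] != 0 -> S (\row_i c i s)) ->
  zariski_closure S (\row_i p i) /\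
  forall f, vanishing_ideal S f -> dirderiv p v f = 0.
Proof.
move=> hc R0 hS; have both f : vanishing_ideal S f -> f.@[p] = 0 /\ dirderiv p v f = 0.
  move=> fS; apply: (germ_zero (germ_meval f hc) R0) => s /hS /fS.
  by move=> <-; apply: meval_eq => i; rewrite mxE.
split=> [f /both[fp _]|f /both[]//].
by rewrite -fp; apply: meval_eq => i; rewrite mxE.
Qed.

Lemma curve_nonvanishing c (p v : 'I_n -> K) (f : {mpoly K[n]}) : (forall i, germ (c i) (p i) (v i)) ->
  f.@[p] != 0 -> exists2 R, R.[0] != 0 & forall s, R.[s] != 0 -> f.@[c ^~ s] != 0.
Proof. by move=> hc; apply/germ_neq0/germ_meval. Qed.

Lemma poly_neq0 R s : R.[s] != 0 -> R != 0.
Proof. by apply: contraNneq => ->; rewrite horner0. Qed.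

(** Closure under lines through two points covers both the row space and its affine slices. *)
Definition affine_set (T : set 'rV[K]_n) :=
  forall (u v : 'rV[K]_n) s, T u -> T v -> T (u + s *: (v - u)).

Definition reciprocal_on (J : {set 'I_n}) (u : 'rV[K]_n) : 'rV[K]_n :=
  \row_i (if i \in J then (u 0 i)^-1 else 0).

Definition reciprocal_set (T : set 'rV[K]_n) (J : {set 'I_n}) :=
  [set p | exists u, [/\ T u, forall i, i \in J -> u 0 i != 0 & p = reciprocal_on J u]].

Lemma germ_line (a b : K) : germ (fun s => a + s * b) a b.
Proof.
have := germD (germ_cst a) (germM (germ_id K) (germ_cst b)).
by rewrite mul0r !addr0 add0r mulr0 add0r mul1r.
Qed.

Lemma germ_reciprocal_line (J : {set 'I_n}) (u v : 'rV[K]_n) i :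
  (forall i, i \in J -> u 0 i != 0) ->
  germ (fun s => reciprocal_on J (u + s *: v) 0 i) (reciprocal_on J u 0 i)
    (if i \in J then - v 0 i / u 0 i ^+ 2 else 0).
Proof.
move=> uJ; rewrite mxE; have [iJ|iJ] := boolP (i \in J).
  under eq_fun do rewrite !mxE iJ; apply: germV; first exact: uJ.
  exact: germ_line.
by under eq_fun do rewrite mxE (negPf iJ); exact: germ_cst.
Qed.

(* The line through two parameter points only meets finitely many points where
   one of the reciprocals is undefined or one of two given polynomials
   vanishes. *)
Lemma irreducible_reciprocal (T : set 'rV[K]_n) J : affine_set T ->
  reciprocal_set T J !=set0 -> irreducible_closed (zariski_closure (reciprocal_set T J)).
Proof.
move=> affT ne; split; first exact: zclosure_closed.
  by case: ne => p Sp; exists p; exact: sub_zclosure.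
have key (f g : {mpoly K[n]}) (u v : 'rV[K]_n) : T u -> T v -> (forall i, i \in J -> u 0 i != 0) ->
    (forall i, i \in J -> v 0 i != 0) ->
    f.@[reciprocal_on J u 0] != 0 -> g.@[reciprocal_on J v 0] != 0 ->
    exists w, [/\ T w, forall i, i \in J -> w 0 i != 0, f.@[reciprocal_on J w 0] != 0
      & g.@[reciprocal_on J w 0] != 0].
  move=> Tu Tv uJ vJ fu gv.
  have [R R0 hR] := curve_nonvanishing (fun i => germ_reciprocal_line (v - u) i uJ) fu.
  (* The same line is read from [v], at parameter 1 - s, whence the composition with [1 - 'X]
     below. *)
  have [R' R'0 hR'] := curve_nonvanishing (fun i => germ_reciprocal_line (u - v) i vJ) gv.
  pose N := \prod_(i in J) ((u 0 i)%:P + (v 0 i - u 0 i) *: 'X).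
  have Rn0 : R * (R' \Po (1 - 'X)) * N != 0.
    rewrite !mulf_neq0 ?(poly_neq0 R0) //.
      by apply: (@poly_neq0 _ 1); rewrite horner_comp !hornerE subrr.
    apply/prodf_neq0 => i iJ; apply: (@poly_neq0 _ 0).
    by rewrite !hornerE ?mulr0 ?addr0 uJ.
  have /closed_nonrootP[s] := Rn0; rewrite /root !hornerM !mulf_eq0 !negb_or.
  rewrite horner_comp !hornerE => /andP[/andP[Rs R's] Ns].
  exists (u + s *: (v - u)); split.
  - exact: affT.
  - move=> i iJ; move: Ns; rewrite /N horner_prod => /prodf_neq0 /(_ i iJ).
    by rewrite !hornerE !mxE mulrC.
  - exact: hR.
  - suff -> : u + s *: (v - u) = v + (1 - s) *: (u - v) by exact: hR'.
    by apply/rowP => i; rewrite !mxE; ring.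
move=> Z1 Z2 c1 c2 eZ.
have outside Z : zariski_closed Z -> Z `<=` zariski_closure (reciprocal_set T J) ->
    zariski_closure (reciprocal_set T J) <> Z ->
    exists f u, [/\ vanishing_ideal Z f, T u, forall i, i \in J -> u 0 i != 0
      & f.@[reciprocal_on J u 0] != 0].
  move=> cZ sub neZ; have [p /not_implyP[[u [Tu uJ ->]] nZ]] :
      exists p, ~ (reciprocal_set T J p -> Z p).
    by apply/existsNP => h; apply: neZ; apply/seteqP; split=> //; exact: zclosure_sub.
  by have [f fZ fp] := zclosed_sep cZ nZ; exists f, u.
have [|n1] := pselect (zariski_closure (reciprocal_set T J) = Z1); first by left.
have [|n2] := pselect (zariski_closure (reciprocal_set T J) = Z2); first by right.
have [|f [u [fZ Tu uJ fu]]] := outside Z1 c1 _ n1; first by rewrite eZ; exact: subsetUl.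
have [|g [v [gZ Tv vJ gv]]] := outside Z2 c2 _ n2; first by rewrite eZ; exact: subsetUr.
have [w [Tw wJ fw gw]] := key f g u v Tu Tv uJ vJ fu gv.
have : (Z1 `|` Z2) (reciprocal_on J w) by rewrite -eZ; apply: sub_zclosure; exists w.
by case=> [/fZ|/gZ] /eqP h; [rewrite h in fw | rewrite h in gw].
Qed.

End Curves.

(** * The complexified row space, tori of given support and their degenerations *)

Section ReciprocalPlane.
Variables (R : realType) (d n : nat) (A : 'M[R]_(d, n)).
Local Notation K := (R[i]%type).
Local Notation toK := (real_complex R).
Local Notation a := (columns A).
Local Notation L := (row_space A).
Local Notation X := (reciprocal_plane A).
Implicit Types (J G S : {set 'I_n}) (u v w p : 'rV[K]_n).

(** Complex forms are evaluated on the real columns, so that real linear relations among columns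
    carry over to points of the complex row space. *)
Definition eval_form (r : 'rV[K]_d) (y : 'cV[R]_d) := (r *m map_mx toK y) 0 0.

Lemma eval_formD r y z : eval_form r (y + z) = eval_form r y + eval_form r z.
Proof. by rewrite /eval_form map_mxD mulmxDr mxE. Qed.

Lemma eval_formZ r k y : eval_form r (k *: y) = toK k * eval_form r y.
Proof. by rewrite /eval_form map_mxZ -scalemxAr mxE. Qed.

Lemma eval_form_sum r (P : pred 'I_n) (y : 'I_n -> 'cV[R]_d) :
  eval_form r (\sum_(i | P i) y i) = \sum_(i | P i) eval_form r (y i).
Proof.
apply: (big_morph (eval_form r)); first exact: eval_formD.
by rewrite /eval_form map_mx0 mulmx0 mxE.
Qed.

Lemma mul_map_entry (r : 'rV[K]_d) i : (r *m map_mx toK A) 0 i = eval_form r (a i).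
Proof. by rewrite /eval_form !mxE; apply: eq_bigr => j _; rewrite !mxE. Qed.

Lemma row_space_form u : L u -> exists r, forall i, u 0 i = eval_form r (a i).
Proof. by case/submxP => r ->; exists r => i; rewrite mul_map_entry. Qed.

Lemma row_space_lin u v k : L u -> L v -> L (u + k *: v).
Proof. by move=> Lu Lv; rewrite /row_space /= addmx_sub // scalemx_sub. Qed.

Lemma row_spaceZ u k : L u -> L (k *: u).
Proof. by move=> Lu; rewrite /row_space /= scalemx_sub. Qed.

Lemma row_space_sum (P : pred 'I_n) (f : 'I_n -> 'rV[K]_n) :
  (forall i, P i -> L (f i)) -> L (\sum_(i | P i) f i).
Proof. by move=> Lf; rewrite /row_space /=; exact: summx_sub. Qed.

Lemma affine_row_space : affine_set L.
Proof.
by move=> u v s Lu Lv; apply: row_space_lin => //; rewrite -scaleN1r; exact: row_space_lin.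
Qed.

Definition real_row (t : 'rV[R]_d) : 'rV[K]_n := map_mx toK (t *m A).

Lemma row_space_real t : L (real_row t).
Proof. by rewrite /real_row map_mxM; exact: submxMl. Qed.

Lemma real_rowE t i : real_row t 0 i = toK (form_at a t i).
Proof. by rewrite /form_at !mxE; congr (toK _); apply: eq_bigr => j _; rewrite !mxE. Qed.

Lemma row_space_relation u i (k : 'I_n -> R) J : L u -> a i = \sum_(j in J) k j *: a j ->
  u 0 i = \sum_(j in J) toK (k j) * u 0 j.
Proof.
move=> /row_space_form[r ur] ei; rewrite ur ei eval_form_sum.
by apply: eq_bigr => j _; rewrite eval_formZ ur.
Qed.

Definition torus J := reciprocal_set L J.

Lemma reciprocal_planeE : X = zariski_closure (torus [set: 'I_n]%SET).
Proof.
congr zariski_closure; apply/seteqP; split=> p [u [Lu u0 ->]]; exists u; split=> //.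
- by apply/rowP => i; rewrite !mxE inE.
- by move=> i; apply: u0; rewrite inE.
- by apply/rowP => i; rewrite !mxE inE.
Qed.

Lemma stratum_closed J : zariski_closed (stratum A J).
Proof.
have -> : stratum A J = [set p | X p /\
    forall f, [set f | exists2 i, i \notin J & f = 'X_i] f -> f.@[p 0] = 0].
  apply/seteqP; split=> p [Xp h]; split=> //; [move=> f [i iJ ->]|move=> i].
    by rewrite mevalXU; apply/eqP/negPn/negP => /h; apply/negP.
  by apply: contraNT => iJ; rewrite -(mevalXU (p 0)) (h 'X_i) //; exists i.
by apply: zclosed_zeros; exact: zclosure_closed.
Qed.

Lemma germ_reciprocal_infinity (u w : K) : w != 0 ->
  germ (fun s => s * (w + s * u)^-1) 0 w^-1.
Proof.
move=> w0; have := germM (germ_id K) (germV w0 (germ_line w u)).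
by rewrite mul0r mul1r mul0r add0r.
Qed.

Lemma limit_to_flat J G u w : J \subset G -> L u -> (forall i, i \in J -> u 0 i != 0) ->
  L w -> (forall i, i \in G -> (w 0 i == 0) = (i \in J)) ->
  zariski_closure (torus G) (reciprocal_on J u) /\
  forall f, vanishing_ideal (torus G) f ->
    dirderiv (reciprocal_on J u 0) (fun i => if i \in G :\: J then (w 0 i)^-1 else 0) f = 0.
Proof.
move=> JG Lu uJ Lw wJ.
(* For s nonzero this is 1 / (u + w / s) on [G], rewritten to be regular at 0; on [J] it is constant
   because [w] vanishes there. *)
pose c i (s : K) := if i \in G :\: J then s * (w 0 i + s * u 0 i)^-1
  else reciprocal_on J u 0 i.
pose N := 'X * \prod_(i in G :\: J) ((w 0 i)%:P + u 0 i *: 'X).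
have [|||lim tan] := @curve_limit K n (torus G) c (reciprocal_on J u 0)
  (fun i => if i \in G :\: J then (w 0 i)^-1 else 0) N.
- move=> i; rewrite /c; have [iGJ|_] := boolP (i \in G :\: J); last exact: germ_cst.
  move/setDP: iGJ => [iG /negPf iJ]; rewrite mxE iJ.
  by apply: germ_reciprocal_infinity; rewrite wJ ?iJ.
- rewrite mulf_neq0 ?polyX_eq0 //; apply/prodf_neq0 => i /setDP[iG /negPf iJ].
  by apply: (@poly_neq0 _ _ 0); rewrite !hornerE ?mulr0 ?addr0 wJ ?iJ.
- move=> s; rewrite hornerM mulf_eq0 negb_or hornerX => /andP[s0].
  rewrite horner_prod => /prodf_neq0 Ns.
  have num i : i \in G -> i \notin J -> w 0 i + s * u 0 i != 0.
    move=> iG iJ; have := Ns i; rewrite inE iJ iG => /(_ isT).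
    by rewrite !hornerE mulrC.
  have val i : i \in G -> i \notin J -> u 0 i + s^-1 * w 0 i = s^-1 * (w 0 i + s * u 0 i).
    by move=> _ _; field.
  have w0 i : i \in J -> w 0 i = 0 by move=> iJ; apply/eqP; rewrite wJ // (fintype.subsetP JG).
  exists (u + s^-1 *: w); split=> [|i iG|]; first exact: row_space_lin.
    rewrite !mxE; have [iJ|iJ] := boolP (i \in J); first by rewrite w0 // mulr0 addr0 uJ.
    by rewrite val // mulf_neq0 ?invr_eq0 // num.
  apply/rowP => i; rewrite !mxE /c inE; have [iJ|iJ] /= := boolP (i \in J).
    by rewrite mxE iJ (fintype.subsetP JG _ iJ) w0 // mulr0 addr0.
  have [iG|iG] := boolP (i \in G); last by rewrite mxE (negPf iJ).
  by rewrite val // invfM invrK.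
- by split=> //; move: lim; congr (zariski_closure _ _); apply/rowP => i; rewrite !mxE.
Qed.

(* The exponents s are distinct, so the polynomial q i vanishes only if all the
   coordinates of i outside J do, that is, only if i is in J. *)
Lemma generic_row J : flat a [set: 'I_n] J ->
  exists2 w, L w & forall i, (w 0 i == 0) = (i \in J).
Proof.
move=> fJ; have [S [t aJ]] := adapted_basis fJ.
pose q i : {poly K} := \sum_(s in S :\: J) toK (form_at a (t s) i) *: 'X^s.
have /closed_nonrootP[x] : \prod_(i in ~: J) q i != 0.
  apply/prodf_neq0 => i; rewrite inE => /(not_flat_form aJ)[s sS c0].
  apply: contraNneq c0 => q0; have := congr1 (fun r : {poly K} => r`_s) q0.
  rewrite coef0 coef_sum (bigD1 s) //= coefZ coefXn eqxx mulr1 big1 ?addr0.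
    by move/eqP; rewrite fmorph_eq0.
  by move=> s' /andP[_ ne]; rewrite coefZ coefXn [val _ == _]eq_sym -val_eqE in ne *;
    rewrite (negPf ne) mulr0.
rewrite /root horner_prod => /prodf_neq0 qx.
exists (\sum_(s in S :\: J) x ^+ s *: real_row (t s)) => [|i].
  by apply: row_space_sum => s _; apply/row_spaceZ/row_space_real.
have -> : (\sum_(s in S :\: J) x ^+ s *: real_row (t s)) 0 i = (q i).[x].
  rewrite summxE horner_sum; apply: eq_bigr => s _.
  by rewrite mxE real_rowE hornerZ hornerXn mulrC.
have [iJ|iJ] := boolP (i \in J); last by apply/negbTE/qx; rewrite inE.
rewrite horner_sum big1 ?eqxx // => s sS.
by rewrite ((adapted_flat aJ i).1 iJ) // rmorph0 scale0r horner0.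
Qed.

Lemma torus_sub_closure J G : flat a [set: 'I_n] J -> J \subset G ->
  torus J `<=` zariski_closure (torus G).
Proof.
move=> fJ JG _ [u [Lu uJ ->]]; have [w Lw wJ] := generic_row fJ.
by have [] := limit_to_flat JG Lu uJ Lw (fun i _ => wJ i).
Qed.

End ReciprocalPlane.

(** * Strata *)

Section RelationPolynomials.
Variables (K : closedFieldType) (n : nat).
Implicit Types (J : {set 'I_n}) (k p v : 'I_n -> K).

Definition coord_prod J : {mpoly K[n]} := \prod_(i in J) 'X_i.

(* The linear relation sum_(j in J) k j / x_j = 0, cleared of denominators. *)
Definition relation_poly J k : {mpoly K[n]} := \sum_(j in J) k j *: coord_prod (J :\ j).

Lemma meval_coord_prod J p : (coord_prod J).@[p] = \prod_(i in J) p i.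
Proof. by rewrite rmorph_prod; apply: eq_bigr => i _; exact: mevalXU. Qed.

Lemma coord_prod_neq0 J p : (forall i, i \in J -> p i != 0) -> (coord_prod J).@[p] != 0.
Proof. by move=> pJ; rewrite meval_coord_prod; exact/prodf_neq0. Qed.

Lemma coord_prodD1 J j : j \in J -> coord_prod J = 'X_j * coord_prod (J :\ j).
Proof. exact: big_setD1. Qed.

Lemma meval_coord_prodD1 J j p : j \in J -> p j != 0 ->
  (coord_prod (J :\ j)).@[p] = (coord_prod J).@[p] / p j.
Proof. by move=> jJ pj; rewrite (coord_prodD1 jJ) mevalM mevalXU mulrAC divff ?mul1r. Qed.

Lemma meval_relation_poly J k p : (forall i, i \in J -> p i != 0) ->
  (relation_poly J k).@[p] = (coord_prod J).@[p] * \sum_(j in J) k j / p j.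
Proof.
move=> pJ; rewrite rmorph_sum mulr_sumr; apply: eq_bigr => j jJ /=.
by rewrite mevalZ (meval_coord_prodD1 jJ) ?pJ // mulrCA.
Qed.

Lemma dirderiv_relation_poly J k p v : (forall i, i \in J -> p i != 0) ->
  \sum_(j in J) k j / p j = 0 ->
  dirderiv p v (relation_poly J k) =
    - (coord_prod J).@[p] * \sum_(j in J) k j * (v j / p j ^+ 2).
Proof.
move=> pJ k0; rewrite dirderiv_sum.
transitivity (\sum_(j in J) (dirderiv p v (coord_prod J) * (k j / p j) -
    (coord_prod J).@[p] * (k j * (v j / p j ^+ 2)))).
  apply: eq_bigr => j jJ; rewrite dirderivZ {1}(coord_prodD1 jJ) dirderivM dirderivX mevalXU.
  by rewrite (meval_coord_prodD1 jJ) ?pJ //; field; exact: pJ.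
by rewrite sumrB -!mulr_sumr k0 mulr0 sub0r mulNr.
Qed.

End RelationPolynomials.

Section Strata.
Variables (R : realType) (d n : nat) (A : 'M[R]_(d, n)).
Local Notation K := (R[i]%type).
Local Notation toK := (real_complex R).
Local Notation a := (columns A).
Local Notation L := (row_space A).
Local Notation X := (reciprocal_plane A).
Implicit Types (J G S : {set 'I_n}) (u v w p : 'rV[K]_n).

Lemma vanishing_reciprocal_plane f :
  (forall u, L u -> (forall i, u 0 i != 0) -> f.@[fun i => (u 0 i)^-1] = 0) ->
  vanishing_ideal X f.
Proof.
move=> h; rewrite reciprocal_planeE vanishing_zclosure => _ [u [Lu u0 ->]].
rewrite -[RHS](h u) // => [|i]; last by rewrite u0 ?inE.
by apply: meval_eq => i; rewrite mxE inE.
Qed.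

Lemma vanishing_relation J (k : 'I_n -> R) : \sum_(j in J) k j *: a j = 0 ->
  vanishing_ideal X (relation_poly J (toK \o k)).
Proof.
move=> k0; apply: vanishing_reciprocal_plane => u Lu u0.
rewrite meval_relation_poly => [|i _]; last by rewrite invr_eq0.
have [r ur] := row_space_form Lu.
rewrite [X in _ * X](_ : _ = eval_form r (\sum_(j in J) k j *: a j)).
  by rewrite k0 /eval_form map_mx0 mulmx0 mxE mulr0.
by rewrite eval_form_sum; apply: eq_bigr => j _ /=; rewrite eval_formZ ur invrK.
Qed.

(** This is 1/x_i - l/x_e = sum of k_j/x_j, cleared of denominators. Where x_i and x_e both vanish,
    the last term has no first-order part, so tangent vectors satisfy v_e = l v_i if no x_j with j
    in [J] vanishes. *)
Lemma vanishing_dependence J (k : 'I_n -> R) i e (l : R) :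
  a i - l *: a e = \sum_(j in J) k j *: a j ->
  vanishing_ideal X (coord_prod K J * ('X_e - toK l *: 'X_i) -
    'X_i * 'X_e * relation_poly J (toK \o k)).
Proof.
move=> ei; apply: vanishing_reciprocal_plane => u Lu u0.
have [r ur] := row_space_form Lu.
rewrite mevalB !mevalM mevalB mevalZ !mevalXU.
rewrite meval_relation_poly => [|j _]; last by rewrite invr_eq0.
have -> : \sum_(j in J) (toK \o k) j / (u 0 j)^-1 = u 0 i - toK l * u 0 e.
  have := congr1 (eval_form r) ei; rewrite eval_form_sum eval_formD -scaleNr eval_formZ.
  rewrite -!ur rmorphN mulNr => ->; apply: eq_bigr => j _.
  by rewrite eval_formZ ur invrK.
by field; rewrite !u0.
Qed.

(** This is 1/x_i = sum of k_j/x_j, cleared of denominators: if x_i = 0, some x_j with j in [J] is 0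
    too, so supports are closed. *)
Lemma vanishing_closure J (k : 'I_n -> R) i : a i = \sum_(j in J) k j *: a j ->
  vanishing_ideal X (coord_prod K J - 'X_i * relation_poly J (toK \o k)).
Proof.
move=> ei; apply: vanishing_reciprocal_plane => u Lu u0.
rewrite mevalB !mevalM mevalXU.
rewrite meval_relation_poly => [|j _]; last by rewrite invr_eq0.
have -> : \sum_(j in J) (toK \o k) j / (u 0 j)^-1 = u 0 i.
  by rewrite (row_space_relation Lu ei); apply: eq_bigr => j _; rewrite invrK.
by field; rewrite !u0.
Qed.

Definition msupport p : {set 'I_n} := [set i | p 0 i != 0]%SET.

Lemma msupport_flat p : X p -> flat a [set: 'I_n] (msupport p).
Proof.
move=> Xp; rewrite flatE finset.eqEsubset sub_closure /=.
apply/fintype.subsetP => i; rewrite closureP inE => /vspan_expand[k ei].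
apply/eqP => pi0; have := vanishing_closure ei Xp.
rewrite mevalB mevalM mevalXU pi0 mul0r subr0; apply/eqP/coord_prod_neq0.
by move=> j; rewrite inE.
Qed.

Lemma torus_msupport J p : torus A J p -> msupport p = J.
Proof.
move=> [u [_ uJ ->]]; apply/setP => i; rewrite inE mxE.
by case: ifP => [/uJ|]; rewrite ?eqxx // invr_eq0.
Qed.

Section AdaptedFlat.
Variables (J S : {set 'I_n}) (t : 'I_n -> 'rV[R]_d).
Hypothesis aJ : adapted a J S t.

(** The relation needed is the expansion of [a i] in the basis. The values y will be 1/p for points
    and v/p^2 for tangent vectors. *)
Lemma flat_relation i (y : 'I_n -> K) : i \in J ->
  (forall k : 'I_n -> R, \sum_(j in J) k j *: a j = 0 -> \sum_(j in J) toK (k j) * y j = 0) ->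
  y i = \sum_(s in S :&: J) toK (form_at a (t s) i) * y s.
Proof.
move=> iJ rel; pose c j := if j \in S then form_at a (t j) i else 0.
(* Stated for any [g] additive in the coefficient, since it serves once for the columns and once for
   the values [y]. *)
have split_sum (V : zmodType) (g : 'I_n -> R -> V) :
    (forall j x z, g j (x - z) = g j x - g j z) ->
    \sum_(j in J) g j ((j == i)%:R - c j) = g i 1 - \sum_(s in S :&: J) g s (form_at a (t s) i).
  move=> gB; have g0 j : g j 0 = 0 by have := gB j 0 0; rewrite !subrr.
  rewrite (eq_bigr (fun j => g j (j == i)%:R - (if j \in S then g j (form_at a (t j) i) else 0))).
    rewrite sumrB (bigD1 i) //= eqxx big1 ?addr0 => [|j /andP[_ /negPf ->]]; last exact: g0.
    congr (_ - _); rewrite -big_mkcondr; apply: eq_bigl => j.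
    by rewrite inE andbC.
  by move=> j _; rewrite gB /c; case: ifP => //; rewrite g0.
have := rel (fun j => (j == i)%:R - c j).
rewrite (split_sum _ (fun j x => x *: a j)) => [|j x z]; last exact: scalerBl.
rewrite -(flat_expand aJ iJ) scale1r subrr => /(_ erefl).
rewrite (split_sum _ (fun j x => toK x * y j)) => [|j x z]; last by rewrite rmorphB mulrBl.
by rewrite rmorph1 mul1r => /eqP; rewrite subr_eq0 => /eqP.
Qed.

(** The reciprocals of [p] on [J] satisfy the relations among the columns of [J], so they extend to
    the row combining the dual rows with coefficients 1/p_s. *)
Lemma torus_of_msupport p : X p -> msupport p = J -> torus A J p.
Proof.
move=> Xp pJ; have p0 i : i \in J -> p 0 i != 0 by rewrite -pJ inE.
have inv i : i \in J -> (p 0 i)^-1 =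
    \sum_(s in S :&: J) toK (form_at a (t s) i) * (p 0 s)^-1.
  move=> iJ; apply: (flat_relation iJ) => k /vanishing_relation /(_ _ Xp) /eqP.
  rewrite meval_relation_poly // mulf_eq0 => /orP[|/eqP //].
  by rewrite (negPf (coord_prod_neq0 p0)).
pose u := \sum_(s in S :&: J) (p 0 s)^-1 *: real_row A (t s).
have uE i : i \in J -> u 0 i = (p 0 i)^-1.
  move=> iJ; rewrite inv // summxE; apply: eq_bigr => s _.
  by rewrite mxE real_rowE mulrC.
exists u; split=> [|i iJ|].
- by apply: row_space_sum => s _; apply/row_spaceZ/row_space_real.
- by rewrite uE // invr_eq0 p0.
- apply/rowP => i; rewrite mxE; case: ifPn => [iJ|]; first by rewrite uE // invrK.
  by rewrite -pJ inE negbK => /eqP.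
Qed.

End AdaptedFlat.

Lemma msupport_torus p : X p -> torus A (msupport p) p.
Proof.
move=> Xp; have [S [t aJ]] := adapted_basis (msupport_flat Xp).
exact: (torus_of_msupport aJ).
Qed.

(** A point of the stratum lies in the torus of its own support, a flat inside [J], which
    degeneration places in the closure. *)
Lemma stratumE J : flat a [set: 'I_n] J -> stratum A J = zariski_closure (torus A J).
Proof.
move=> fJ; apply/seteqP; split=> [p [Xp pJ]|].
  apply: (torus_sub_closure (msupport_flat Xp)); last exact: msupport_torus.
  by apply/fintype.subsetP => i; rewrite inE => /pJ.
apply: zclosure_sub; first exact: stratum_closed.
move=> p pJ; split=> [|i].
  by rewrite reciprocal_planeE; apply: (torus_sub_closure fJ) pJ; exact: finset.subsetT.
by move=> pi0; rewrite -(torus_msupport pJ) inE.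
Qed.

Lemma stratumT : stratum A [set: 'I_n]%SET = X.
Proof. by apply/seteqP; split=> [p []//|p Xp]; split=> // i _; rewrite finset.in_setT. Qed.

Lemma stratum_sub J : stratum A J `<=` X.
Proof. by move=> p []. Qed.

Lemma stratumS J G : J \subset G -> stratum A J `<=` stratum A G.
Proof. by move=> /fintype.subsetP JG p [Xp pJ]; split=> // i /pJ /JG. Qed.

End Strata.

(** * Tangent spaces *)

Lemma mrank_dual_family (K : fieldType) n (x : 'I_n -> 'rV[K]_n) (I : {set 'I_n}) :
  (forall s s', s \in I -> s' \in I -> x s 0 s' = (s == s')%:R) -> mrank x I = #|I|.
Proof.
move=> xI; have i0 : indep x finset.set0 by rewrite /indep /image_mem enum_set0 nil_free.
have [B [_ BI iB eB]] := indep_extend i0 (finset.sub0set I).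
suff -> : I = B by exact: mrank_indep.
apply/eqP; rewrite finset.eqEsubset BI andbT; apply/fintype.subsetP => e eI.
apply/negPn/negP => eB'; have := vspan_mem x eI; rewrite -eB => /vspan_expand[k xe].
have := xI e e eI eI; rewrite eqxx xe summxE big1 => [/eqP|s sB].
  by rewrite eq_sym oner_eq0.
rewrite mxE (xI s e (fintype.subsetP BI s sB) eI).
by have [es|_] := eqVneq s e; [rewrite -es sB in eB' | rewrite mulr0].
Qed.

Section TangentSpace.
Variables (R : realType) (d n : nat) (A : 'M[R]_(d, n)).
Local Notation K := (R[i]%type).
Local Notation toK := (real_complex R).
Local Notation a := (columns A).
Local Notation L := (row_space A).
Local Notation X := (reciprocal_plane A).
Local Notation tangent p := (tangent_space X p).
Variables (J S : {set 'I_n}) (t : 'I_n -> 'rV[R]_d) (p : 'rV[K]_n).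
Hypotheses (fJ : flat a [set: 'I_n] J) (aJ : adapted a J S t) (pJ : torus A J p).

Lemma torus_reciprocal_plane : torus A J `<=` X.
Proof. by move=> q Jq; apply: (@stratum_sub _ _ _ _ J); rewrite stratumE //; exact: sub_zclosure. Qed.

Lemma torus_neq0 i : i \in J -> p 0 i != 0.
Proof. by rewrite -(torus_msupport pJ) inE. Qed.

Lemma torus_eq0 i : i \notin J -> p 0 i = 0.
Proof. by rewrite -(torus_msupport pJ) inE negbK => /eqP. Qed.

Lemma tangent_lin (c : K) v w : tangent p v -> tangent p w -> tangent p (c *: v + w).
Proof.
move=> tv tw f fX; rewrite (eq_bigr (fun i => c * ((mderiv i f).@[p 0] * v 0 i) +
  (mderiv i f).@[p 0] * w 0 i)) => [|i _]; last by rewrite !mxE; ring.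
by rewrite big_split -mulr_sumr /= tv // tw // mulr0 addr0.
Qed.

Lemma tangent0 : tangent p 0.
Proof. by move=> f _; rewrite big1 // => i _; rewrite mxE mulr0. Qed.

Lemma tangentZ (c : K) v : tangent p v -> tangent p (c *: v).
Proof. by move=> tv; rewrite -[_ *: _]addr0; apply: tangent_lin => //; exact: tangent0. Qed.

Lemma tangentD v w : tangent p v -> tangent p w -> tangent p (v + w).
Proof. by move=> tv; rewrite -[v]scale1r; exact: tangent_lin. Qed.

(** Differentiating the relation polynomials at [p] shows that v/p^2 obeys the relations among the
    columns of [J]. *)
Lemma tangent_on_flat v i : tangent p v -> i \in J -> v 0 i / p 0 i ^+ 2 =
  \sum_(s in S :&: J) toK (form_at a (t s) i) * (v 0 s / p 0 s ^+ 2).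
Proof.
move=> tv iJ; apply: (flat_relation aJ (y := fun i => v 0 i / p 0 i ^+ 2) iJ) => k /vanishing_relation kX.
have E0 := coord_prod_neq0 torus_neq0.
have k0 : \sum_(j in J) (toK \o k) j / p 0 j = 0.
  have /eqP := kX _ (torus_reciprocal_plane pJ).
  by rewrite (meval_relation_poly _ torus_neq0) mulf_eq0 (negPf E0) => /eqP.
have := tv _ kX; rewrite -/(dirderiv (p 0) (v 0) _) (dirderiv_relation_poly _ torus_neq0 k0).
by move/eqP; rewrite mulf_eq0 oppr_eq0 (negPf E0) => /eqP.
Qed.

Lemma tangent_parallel v i e (l : R) : tangent p v -> i \notin J -> e \notin J ->
  a i - l *: a e \in vspan a J -> v 0 e = toK l * v 0 i.
Proof.
move=> tv iJ eJ /vspan_expand[k /vanishing_dependence /tv].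
rewrite -/(dirderiv (p 0) (v 0) _) dirderivB !dirderivM dirderivB dirderivZ !dirderivX.
rewrite !mevalM !mevalB mevalZ !mevalXU (torus_eq0 iJ) (torus_eq0 eJ).
rewrite !(oppr0, mulr0, mul0r, addr0, add0r) => /eqP.
by rewrite mulf_eq0 (negPf (coord_prod_neq0 torus_neq0)) subr_eq0 => /eqP.
Qed.

(** The curve 1 / (u - s w) on [J] has velocity w / u^2 = w p^2 at s = 0. *)
Lemma tangent_row w : L w ->
  tangent p (\row_i (if i \in J then w 0 i * p 0 i ^+ 2 else 0)).
Proof.
move=> Lw; case: pJ => u [Lu uJ pE].
pose N := \prod_(i in J) ((u 0 i)%:P - w 0 i *: 'X).
have N0 : N != 0.
  apply/prodf_neq0 => i iJ; apply: (@poly_neq0 _ _ 0).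
  by rewrite !hornerE ?mulr0 ?subr0 uJ.
have [|_ tan f fX] := curve_limit (S := torus A J)
  (fun i => germ_reciprocal_line (- w) i uJ) N0.
  move=> s; rewrite horner_prod => /prodf_neq0 Ns.
  exists (u + s *: - w); split=> [|i iJ|]; first by rewrite scalerN -scaleNr; exact: row_space_lin.
    by have := Ns i iJ; rewrite !hornerE !mxE mulrN [s * _]mulrC.
  by apply/rowP => i; rewrite !mxE.
have /tan : vanishing_ideal (torus A J) f by move=> q /torus_reciprocal_plane; exact: fX.
rewrite -pE => df; apply: etrans df; apply: eq_bigr => i _; congr (_ * _); rewrite mxE.
by case: ifP => // iJ; rewrite mxE opprK pE mxE iJ exprVn.
Qed.

(** A dual row nonzero at [e] vanishes on the cover [G] exactly along [J], since [G] is a line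
    modulo the span of [J]. The degeneration from [G] to [J] along it has a tangent supported on
    [G :\: J], here scaled to be 1 at [e]. *)
Lemma tangent_cover e : e \notin J -> exists x, [/\ tangent p x, x 0 e = 1 &
  forall i, i \notin closure a (e |: J) :\: J -> x 0 i = 0].
Proof.
move=> eJ; have [s sS se] := not_flat_form aJ eJ.
pose G := closure a (e |: J); pose w := real_row A (t s).
have GJ : G \in covers a J by apply: closure1_covers; rewrite -(mem_flat fJ).
have eG : e \in G by rewrite closureP vspan_mem ?setU11.
have JG : J \subset G by move: GJ; rewrite inE => /and3P[].
have wG i : i \in G -> (w 0 i == 0) = (i \in J).
  move=> iG; rewrite real_rowE fmorph_eq0; have [iJ|iJ] := boolP (i \in J).
    by rewrite ((adapted_flat aJ i).1 iJ) ?eqxx.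
  have [l li] := covers_proportional fJ GJ eG eJ iG.
  have : form_at a (t s) i - l * form_at a (t s) e = 0.
    rewrite -(form_vspan0 aJ sS li) mulmxBr -scalemxAr [RHS]mxE.
    by congr (_ + _); rewrite [RHS]mxE; congr (- _); rewrite [RHS]mxE.
  move=> /eqP; rewrite subr_eq0 => /eqP ->.
  rewrite mulf_eq0 (negPf se) orbF; apply: contraNF iJ => /eqP l0.
  by rewrite (mem_flat fJ) -[a i]subr0 -[0](scale0r (a e)) -l0.
case: pJ => u [Lu uJ pE].
have [_ tan] := limit_to_flat JG Lu uJ (row_space_real A (t s)) wG.
exists (w 0 e *: \row_i (if i \in G :\: J then (w 0 i)^-1 else 0)); split.
- apply: tangentZ => f fX.
  have /tan : vanishing_ideal (torus A G) f.
    move=> q qG; apply: fX; rewrite reciprocal_planeE.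
    apply: (torus_sub_closure (closure_flat _ _) _ qG); exact: finset.subsetT.
  by rewrite -pE => df; apply: etrans df; apply: eq_bigr => i _; congr (_ * _); rewrite mxE.
- by rewrite mxE [X in _ * X]mxE inE eJ eG mulfV // wG.
- by move=> i /negPf iGJ; rewrite mxE [X in _ * X]mxE iGJ mulr0.
Qed.

Lemma tangent_space_dim : exists2 T : {vspace 'rV[K]_n},
  (forall v, v \in T <-> tangent p v) & \dim T = (mrank a J + #|covers a J|)%N.
Proof.
(* [E] holds one representative of [G :\: J] for each cover [G], namely the element that [pick]
   selects. *)
pose E := [set e | (e \notin J) && ([pick i in closure a (e |: J) :\: J] == Some e)]%SET.
have cover e : e \notin J -> closure a (e |: J) \in covers a J.
  by move=> eJ; apply: closure1_covers; rewrite -(mem_flat fJ).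
have EJ e : e \in E -> e \notin J by rewrite inE => /andP[].
have clE i e : i \notin J -> e \in closure a (i |: J) -> e \notin J ->
    closure a (i |: J) = closure a (e |: J).
  by move=> iJ ei eJ; rewrite (coversE (cover i iJ) ei) -?(mem_flat fJ).
have Einj : {in E &, injective (fun e => closure a (e |: J))}.
  move=> e e'; rewrite !inE => /andP[_ /eqP pe] /andP[_ /eqP pe'] eqe.
  by move: pe; rewrite eqe pe' => -[].
have repE i : i \notin J -> exists2 e, e \in E & e \in closure a (i |: J).
  move=> iJ; have iG : i \in closure a (i |: J) by rewrite closureP vspan_mem ?setU11.
  case epick: [pick e in closure a (i |: J) :\: J] => [e|]; last first.
    by move: epick; case: pickP => // /(_ i); rewrite inE iJ iG.
  have /setDP[eG eJ] : e \in closure a (i |: J) :\: J.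
    by move: epick; case: pickP => // x xG [<-].
  by exists e => //; rewrite inE eJ -(clE _ _ iJ eG eJ) epick eqxx.
have cardE' : #|E| = #|covers a J|.
  rewrite -(card_in_imset Einj); apply: eq_card => G; apply/imsetP/idP => [[e eE ->]|GJ].
    exact/cover/EJ.
  move: (GJ); rewrite inE => /and3P[_ _ /eqP rG].
  have [|i iG iJ] := subsetPn (_ : ~~ (G \subset J)).
    by apply/negP => GsJ; move: (dimvS (vspanS a GsJ)); rewrite -!/(mrank _ _) rG ltnn.
  have eG : G = closure a (i |: J) by apply: coversE => //; rewrite -(mem_flat fJ).
  by have [e eE ei] := repE _ iJ; exists e => //; rewrite eG; apply: clE => //; exact: EJ.
have /fin_all_exists[y yP] e : exists y, e \notin J -> [/\ tangent p y, y 0 e = 1 &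
    forall i, i \notin closure a (e |: J) :\: J -> y 0 i = 0].
  have [_|eJ] := boolP (e \in J); first by exists 0.
  by have [y yP] := tangent_cover eJ; exists y.
(* The factors make entry [s] of [x s] equal to 1 for [s] in [I]; the family is then dual to the
   coordinates in [I]. *)
pose x s : 'rV[K]_n := if s \in J then
  (p 0 s ^+ 2)^-1 *: \row_i (if i \in J then real_row A (t s) 0 i * p 0 i ^+ 2 else 0) else y s.
pose I := (S :&: J) :|: E.
have tanx s : tangent p (x s).
  rewrite /x; case: ifPn => [_|sJ]; last by have [] := yP _ sJ.
  exact/tangentZ/tangent_row/row_space_real.
have x1E s i : s \in J -> x s 0 i =
    if i \in J then (p 0 s ^+ 2)^-1 * (toK (form_at a (t s) i) * p 0 i ^+ 2) else 0.
  by move=> sJ; rewrite /x sJ mxE [X in _ * X]mxE real_rowE; case: ifP; rewrite ?mulr0.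
have x2E s : s \notin J -> x s = y s by move=> /negPf sJ; rewrite /x sJ.
have dual s s' : s \in I -> s' \in I -> x s 0 s' = (s == s')%:R.
  move=> /setUP[/setIP[sS sJ]|sE] /setUP[/setIP[s'S s'J]|s'E].
  - rewrite x1E // s'J (dual_form aJ) //.
    have [->|_] := eqVneq s s'; last by rewrite rmorph0 mul0r mulr0.
    by rewrite rmorph1 mul1r mulVf // expf_neq0 // torus_neq0.
  - have s'J := EJ _ s'E; rewrite x1E // (negPf s'J).
    by case: eqP => // ss'; rewrite -ss' sJ in s'J.
  - have sJ := EJ _ sE; rewrite x2E //; have [_ _ ->] := yP _ sJ.
      by case: eqP => // ss'; rewrite ss' s'J in sJ.
    by rewrite inE s'J.
  - have sJ := EJ _ sE; rewrite x2E //; have [_ y1 y0] := yP _ sJ.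
    have [<-//|ne] := eqVneq s s'; apply: y0; rewrite inE negb_and orbC.
    apply/orP; left; apply: contra ne => s's; apply/eqP/Einj => //.
    by apply: clE => //; exact: EJ.
exists (vspan x I); last first.
  rewrite -/(mrank x I) (mrank_dual_family dual) cardsU (adapted_mrank aJ) cardE'.
  rewrite (_ : _ :&: E = finset.set0) ?cards0 ?subn0 //.
  apply/setP => i; rewrite [RHS]inE; apply/negbTE/negP => /setIP[/setIP[_ iJ] /EJ].
  by rewrite iJ.
move=> v; split=> [/vspan_expand[k ->]|tv].
  by apply: (big_ind (tangent p)) => [|v1 v2|i _];
    [exact: tangent0 | exact: tangentD | exact: tangentZ].
(* By duality the coefficients must be the coordinates of [v]. Entries in [J] agree by
   [tangent_on_flat], the others by [tangent_parallel] within each cover. *)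
suff -> : v = \sum_(s in I) v 0 s *: x s.
  by apply: rpred_sum => s sI; rewrite rpredZ // vspan_mem.
apply/rowP => i; rewrite summxE.
have disj s : s \in E -> s \notin S :&: J.
  by move=> /EJ sJ; rewrite inE (negPf sJ) andbF.
rewrite (eq_bigl [predU S :&: J & E]) => [|s]; last by rewrite !inE.
rewrite bigU /=; last first.
  by rewrite disjoint_sym disjoint_subset; apply/fintype.subsetP => s /disj.
have [iJ|iJ] := boolP (i \in J).
  rewrite [X in _ + X]big1 ?addr0 => [|s sE]; last first.
    rewrite mxE x2E ?EJ //; have [_ _ ->] := yP _ (EJ _ sE); first by rewrite mulr0.
    by rewrite inE iJ.
  rewrite -[v 0 i](@mulfVK _ (p 0 i ^+ 2)) ?expf_neq0 ?torus_neq0 //.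
  rewrite (tangent_on_flat tv iJ) mulr_suml; apply: eq_bigr => s /setIP[sS sJ].
  rewrite mxE x1E // iJ.
  by ring.
rewrite big1 ?add0r => [|s /setIP[_ sJ]]; last by rewrite mxE x1E // (negPf iJ) mulr0.
have [e eE ei] := repE _ iJ; have eJ := EJ _ eE.
rewrite (bigD1 e) //= big1 ?addr0 => [|s /andP[sE ne]].
  rewrite mxE x2E //; have [ty y1 _] := yP _ eJ.
  have ie : i \in closure a (e |: J) by rewrite -(clE _ _ iJ ei eJ) closureP vspan_mem ?setU11.
  have ee : e \in closure a (e |: J) by rewrite closureP vspan_mem ?setU11.
  have [l li] := covers_proportional fJ (cover _ eJ) ee eJ ie.
  rewrite (tangent_parallel tv iJ eJ li) mulrAC -(tangent_parallel ty iJ eJ li) y1.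
  by rewrite mul1r.
have sJ := EJ _ sE; rewrite mxE x2E //; have [_ _ ->] := yP _ sJ; first by rewrite mulr0.
rewrite inE negb_and orbC; apply/orP; left; apply: contra ne => i_s.
by apply/eqP/Einj => //; rewrite (clE _ _ sJ i_s iJ); exact: clE.
Qed.

End TangentSpace.

(** * Codimension *)

Section Codimension.
Variables (R : realType) (d n : nat) (A : 'M[R]_(d, n)).
Hypotheses (rank_A : \rank A = d) (col_A : forall j : 'I_n, col j A != 0).
Local Notation K := (R[i]%type).
Local Notation toK := (real_complex R).
Local Notation a := (columns A).
Local Notation L := (row_space A).
Local Notation X := (reciprocal_plane A).
Implicit Types (J G S B : {set 'I_n}) (u v w p : 'rV[K]_n).

Lemma mrank_columns : mrank a [set: 'I_n] = d.
Proof.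
have -> : mrank a [set: 'I_n] = \dim {:'cV[R]_d}; last by rewrite dimvf dim_matrix; exact: muln1.
congr (\dim _); apply/eqP; rewrite eqEsubv subvf /=; apply/subvP => x _.
apply/negPn/negP => /separating_form[t t0 t1].
have tA : t *m A = 0.
  apply/rowP => i; rewrite [RHS]mxE -(t0 (a i)); last by rewrite vspan_mem ?finset.in_setT.
  by rewrite !mxE; apply: eq_bigr => j _; rewrite !mxE.
have /row_free_inj inj : row_free A by rewrite /row_free rank_A.
have t00 : t = 0 by apply: inj; rewrite tA mul0mx.
by move: t1; rewrite t00 mul0mx mxE => /eqP; rewrite eq_sym oner_eq0.
Qed.

Lemma reciprocal_plane_reciprocals :
  X = zariski_closure (reciprocals (map_mx toK A)).
Proof.
congr zariski_closure; apply/seteqP; split=> p.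
  by move=> [u [/submxP[t ->] u0 ->]]; exists t.
move=> [t [u0 ->]]; exists (t *m map_mx toK A); split=> //.
exact: submxMl.
Qed.

Lemma chain_length_reciprocal_plane Z Z' k : chain_from_to X Z Z' k -> (k <= d)%N.
Proof.
by move=> [C [hC _ _]]; move: hC; rewrite reciprocal_plane_reciprocals;
  exact: chain_length_reciprocals.
Qed.

(** The matroid is loopless because no column is zero; [generic_row] then yields a row without zero
    entries. *)
Lemma flat_set0 : flat a [set: 'I_n] finset.set0.
Proof.
rewrite flatE; apply/eqP/setP => i; rewrite closureP inE; apply/esym/negbTE.
apply: contra (col_A i) => /vspan_expand[k].
by rewrite big_set0 => <-.
Qed.

Lemma flat_setT : flat a [set: 'I_n] [set: 'I_n]%SET.
Proof. by rewrite flatE finset.eqEsubset sub_closure finset.subsetT. Qed.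

Lemma torus_nonempty J : torus A J !=set0.
Proof.
have [u Lu u0] := generic_row flat_set0.
exists (reciprocal_on J u), u; split=> // i _.
by rewrite u0 inE.
Qed.

Lemma stratum_irreducible J : flat a [set: 'I_n] J -> irreducible_closed (stratum A J).
Proof.
move=> fJ; rewrite stratumE //; apply: irreducible_reciprocal; first exact: affine_row_space.
exact: torus_nonempty.
Qed.

(** Each step passes to the cover generated by an element [e] outside [J]; it is strict because the
    torus of the cover has nonzero coordinate [e]. *)
Lemma chain_strata J : flat a [set: 'I_n] J ->
  chain_from_to X (stratum A J) X (d - mrank a J).
Proof.
have [k] := ubnP (n - #|J|); elim: k J => // k IH J lek fJ.
have [->|nT] := eqVneq J [set: 'I_n]%SET.
  rewrite mrank_columns subnn stratumT; apply: chain_refl => //; rewrite -stratumT.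
  exact/stratum_irreducible/flat_setT.
have [e eJ] : exists e, e \notin J.
  apply/existsP; apply: contraR nT; rewrite negb_exists => /forallP h.
  by apply/eqP/setP => i; rewrite finset.in_setT; apply/negPn/h.
have naJ : a e \notin vspan a J by rewrite -(mem_flat fJ).
have := closure1_covers naJ; set G := closure _ _.
rewrite inE => /and3P[fG JG /eqP rG].
have eG : e \in G by rewrite closureP vspan_mem ?setU11.
have JpG : J \proper G by apply/properP; split=> //; exists e.
have := dimvS (vspanS a (finset.subsetT G)).
rewrite -!/(mrank _ _) mrank_columns rG => ltd.
rewrite -(subnSK ltd) -add1n -rG; apply: (@chain_trans _ _ _ _ (stratum A G)).
  apply: chain_step; [exact: stratum_irreducible | exact: stratum_irreducible | |].
    split; first exact: stratumS.
    have [p pG] := torus_nonempty G.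
    move=> /(_ p) []; first by rewrite stratumE //; exact: sub_zclosure.
    by move=> _ /(_ e); rewrite (torus_neq0 pG eG) (negPf eJ) => /(_ isT).
  exact: stratum_sub.
rewrite ltnS in lek; apply: IH => //; apply: leq_trans lek; rewrite ltn_sub2l ?proper_card //.
by rewrite -[X in (_ < X)%N](card_ord n) -cardsT proper_card // properT.
Qed.

(** * Chains from a point to its stratum *)

Section PointChain.
Variables (J S : {set 'I_n}) (t : 'I_n -> 'rV[R]_d) (u : 'rV[K]_n).
Hypotheses (fJ : flat a [set: 'I_n] J) (aJ : adapted a J S t).
Hypotheses (Lu : L u) (uJ : forall i, i \in J -> u 0 i != 0).

(** [B] lists the basis coordinates set free: none gives a point, all of [S :&: J] the whole
    stratum. *)
Definition partial_slice B := [set v | L v /\ forall s, s \in (S :&: J) :\: B -> v 0 s = u 0 s].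

Lemma affine_slice B : affine_set (partial_slice B).
Proof.
move=> v w s [Lv hv] [Lw hw]; split; first exact: affine_row_space.
by move=> r rB; rewrite !mxE hv // hw // subrr mulr0 addr0.
Qed.

Lemma slice_mem B : partial_slice B u.
Proof. by []. Qed.

Lemma slice_irreducible B :
  irreducible_closed (zariski_closure (reciprocal_set (partial_slice B) J)).
Proof.
apply: irreducible_reciprocal; first exact: affine_slice.
by exists (reciprocal_on J u), u; split=> //; exact: slice_mem.
Qed.

Lemma slice_sub B : zariski_closure (reciprocal_set (partial_slice B) J) `<=` X.
Proof.
apply: subset_trans (@stratum_sub _ _ _ A J); rewrite stratumE //.
by apply: zclosureS => p [v [[Lv _] vJ ->]]; exists v.
Qed.

Lemma chain_slices B : B \subset S :&: J -> chain_from_to X [set reciprocal_on J u]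
  (zariski_closure (reciprocal_set (partial_slice B) J)) #|B|.
Proof.
have [k] := ubnP #|B|; elim: k B => // k IH B ltk BS.
have [->|/set0Pn[b bB]] := eqVneq B finset.set0.
  (* The basis coordinates determine a row on all of [J], by [flat_expand]. *)
  rewrite cards0; have e0 : reciprocal_set (partial_slice finset.set0) J = [set reciprocal_on J u].
    apply/seteqP; split=> [_ [v [[Lv vu] vJ ->]]|_ ->]; last by exists u.
    apply/rowP => i; rewrite !mxE; case: ifP => // iJ; congr _^-1.
    rewrite (row_space_relation Lv (flat_expand aJ iJ)) (row_space_relation Lu (flat_expand aJ iJ)).
    by apply: eq_bigr => s sSJ; rewrite vu // finset.setD0.
  have := slice_irreducible finset.set0; have := @slice_sub finset.set0.
  rewrite e0 (zclosed1 (reciprocal_on J u)) => sub irr.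
  exact: chain_refl.
have sBb : B :\ b \subset B by exact: subD1set.
have cB : #|B| = (#|B :\ b| + 1)%N by rewrite (cardsD1 b) bB addnC.
rewrite cB; apply: chain_trans (IH _ _ _) _; first by rewrite cB addn1 ltnS in ltk.
  exact: fintype.subset_trans sBb BS.
have /setIP[bS bJ] := fintype.subsetP BS b bB.
apply: chain_step; [exact: slice_irreducible | exact: slice_irreducible | | exact: slice_sub].
split.
  apply: zclosureS => p [v [[Lv hv] vJ ->]]; exists v; split=> //; split=> // s /setDP[sS sB].
  by apply: hv; rewrite finset.in_setD sS andbT; apply: contra sB => /(fintype.subsetP sBb).
(* Moving [u] along the dual row of [b] changes, among the basis coordinates, only the one at [b];
   the resulting point is outside the smaller slice, on which x_b = 1/u_b. *)
pose c := real_row A (t b); have Lc : L c by exact: row_space_real.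
have cJ s : s \in S -> c 0 s = (b == s)%:R.
  by move=> sS; rewrite real_rowE (dual_form aJ) // rmorph_nat.
clearbody c.
pose N := 'X * \prod_(i in J) ((u 0 i)%:P + c 0 i *: 'X).
have /closed_nonrootP[y] : N != 0.
  rewrite mulf_neq0 ?polyX_eq0 //; apply/prodf_neq0 => i iJ; apply: (@poly_neq0 _ _ 0).
  by rewrite !hornerE ?mulr0 ?addr0 uJ.
rewrite /root hornerM mulf_eq0 negb_or hornerX horner_prod => /andP[y0 /prodf_neq0 Ny].
have nz i : i \in J -> (u + y *: c) 0 i != 0.
  by move=> iJ; have := Ny i iJ; rewrite !hornerE => ?; rewrite mxE [X in _ + X]mxE mulrC.
have uyb : (u + y *: c) 0 b = u 0 b + y by rewrite mxE [X in _ + X]mxE cJ // eqxx mulr1.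
have qB : reciprocal_set (partial_slice B) J (reciprocal_on J (u + y *: c)).
  exists (u + y *: c); split=> //; split; first exact: row_space_lin.
  move=> s /setDP[/setIP[sS sJ] sB]; rewrite mxE [X in _ + X]mxE cJ //.
  by case: eqP => [bs|_]; [rewrite -bs bB in sB | rewrite mulr0 addr0].
pose f : {mpoly K[n]} := 'X_b - (u 0 b)^-1%:MP.
have fB : vanishing_ideal (reciprocal_set (partial_slice (B :\ b)) J) f.
  move=> _ [v [[Lv hv] vJ ->]]; rewrite mevalB mevalXU mevalC mxE bJ hv ?subrr //.
  by rewrite !inE bS bJ eqxx.
move=> /(_ _ (sub_zclosure qB)); rewrite -vanishing_zclosure in fB => /fB /eqP.
rewrite mevalB mevalXU mevalC mxE bJ subr_eq0 (inj_eq invr_inj) uyb.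
by rewrite -subr_eq0 addrAC subrr add0r (negPf y0).
Qed.

Lemma chain_point_stratum :
  chain_from_to X [set reciprocal_on J u] (stratum A J) (mrank a J).
Proof.
have := chain_slices (subxx _); rewrite -(adapted_mrank aJ) stratumE //.
congr (chain_from_to _ _ (zariski_closure _) _).
apply/seteqP; split=> p [v]; first by case=> -[Lv _] vJ ->; exists v.
by case=> Lv vJ ->; exists v; split=> //; split=> // s; rewrite finset.setDv inE.
Qed.

End PointChain.

Lemma chain_point_flat J p : flat a [set: 'I_n] J -> torus A J p ->
  chain_from_to X [set p] (stratum A J) (mrank a J).
Proof.
move=> fJ [u [Lu uJ ->]]; have [S [t aJ]] := adapted_basis fJ.
exact: chain_point_stratum aJ Lu uJ.
Qed.

(** * Codimension of strata and points, and the singular locus *)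

Lemma mrank_le J : (mrank a J <= d)%N.
Proof.
apply: leq_trans (_ : (mrank a [set: 'I_n] <= d)%N); last by rewrite mrank_columns.
exact/dimvS/vspanS/finset.subsetT.
Qed.

(** Any chain starting at [Z], preceded by the chain of length [l] from a point, has length at most
    [d]; this bounds it by [k]. *)
Lemma has_codimI Z l k : chain_from_to X Z X k -> (l + k)%N = d ->
  (exists q, chain_from_to X [set q] Z l) -> has_codim Z X k.
Proof.
move=> [C [hC C0 Ck]] lk [q cq]; split; first by exists C.
move=> C' k' hC' C0'; rewrite -(leq_add2l l) lk.
by apply: chain_length_reciprocal_plane; apply: chain_trans cq _; exists C'.
Qed.

Lemma codim_stratum J : flat a [set: 'I_n] J ->
  has_codim (stratum A J) X (d - mrank a J).
Proof.
move=> fJ; apply: (has_codimI (l := mrank a J)); first exact: chain_strata.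
  by rewrite subnKC // mrank_le.
by have [p pJ] := torus_nonempty J; exists p; exact: chain_point_flat.
Qed.

Lemma codim_point p : X p -> has_codim [set p] X d.
Proof.
move=> Xp; have fJ := msupport_flat Xp; have pJ := msupport_torus Xp.
apply: (has_codimI (l := 0)) => //.
  have := chain_trans (chain_point_flat fJ pJ) (chain_strata fJ).
  by rewrite subnKC // mrank_le.
exists p; have [C [[iC _] C0 _]] := chain_point_flat fJ pJ.
by have := iC 0%N isT; rewrite C0 => -[irr sub]; exact: chain_refl.
Qed.

(** Every point has codimension [d], so regularity asks that the rank of the support plus the number
    of its covers be [d], which is [basicE]. *)
Lemma regular_pointE p : X p -> regular_point X p <->
  basic (contraction a (msupport p)) (~: msupport p).
Proof.
move=> Xp; have fJ := msupport_flat Xp; have pJ := msupport_torus Xp.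
have [S [t aJ]] := adapted_basis fJ.
have [T TE dT] := tangent_space_dim fJ aJ pJ.
rewrite basicE // mrank_columns addnC -dT; split=> [[T' T'E /has_codim_unique cod]|/eqP dTd].
  have -> : T = T' by apply/vspaceP => v; apply/idP/idP => /= [/TE/T'E|/T'E/TE].
  by rewrite (cod _ (codim_point Xp)).
by exists T => //; rewrite dTd; exact: codim_point.
Qed.

Lemma singular_locusE : singular_locus X =
  \bigcup_(J in [set J : {set 'I_n} |
                 flat a [set: 'I_n]%SET J /\ ~~ basic (contraction a J) (~: J)%SET])
    stratum A J.
Proof.
apply/seteqP; split=> p.
  move=> [Xp /(regular_pointE Xp)/negP nb]; exists (msupport p); first by split; [exact: msupport_flat|].
  by split=> // i; rewrite inE.
move=> [J [fJ nb] [Xp pJ]]; split=> // /(regular_pointE Xp).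
move=> /(basicS (msupport_flat Xp) fJ) b; case/negP: nb; apply: b.
by apply/fintype.subsetP => i; rewrite inE => /pJ.
Qed.

End Codimension.

Theorem corollary26 (R : realType) (d n : nat) (A : 'M[R]_(d, n))
    (rank_A : \rank A = d) (col_A : forall j : 'I_n, col j A != 0) :
  pure_codim 2 (singular_locus (reciprocal_plane A)) (reciprocal_plane A) /\
  singular_locus (reciprocal_plane A) =
    \bigcup_(J in [set J : {set 'I_n} |
                   flat (columns A) [set: 'I_n]%SET J /\
                   ~~ basic (contraction (columns A) J) (~: J)%SET])
      stratum A J.
Proof.
have eq := singular_locusE rank_A col_A; split=> //; rewrite {}eq.
set D := [set J | _]; have cJ J : D J -> zariski_closed (stratum A J).
  by move=> _; exact: stratum_closed.
split=> [|Z [iZ ZY maxZ]]; first exact: zclosed_bigcup.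
have [J [fJ nb] ZJ] := irreducible_sub_bigcup cJ iZ ZY.
(* The stratum containing the component [Z] lies in that of a non-basic flat of corank 2, itself
   irreducible in the singular locus; maximality makes them equal. *)
have [J' [fJ' JJ' nb' rJ']] := nonbasic_corank2 fJ nb.
have <- : stratum A J' = Z.
  apply: maxZ; first exact: stratum_irreducible.
    by move=> p pJ'; exists J'.
  exact: subset_trans ZJ (stratumS JJ').
have := codim_stratum rank_A col_A fJ'.
suff -> : (d - mrank (columns A) J')%N = 2%N by [].
by apply/eqP; rewrite -(eqn_add2l (mrank (columns A) J')) rJ' subnKC ?mrank_le // mrank_columns.
Qed.
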